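(* Let $\alpha>0$ be a non-integer and let $f:[0,1]\to(0,1)$. Then $f\in C^\alpha[0,1]$ if and only if $f$ has a series representation $f(x)=\sum_{n=1}^\infty F_n(x)$ on $[0,1]$ with $F_n\in\mathcal{B}^+_n$ for all $n\ge1$, and there is a constant $C$ such that $$\sum_{k>n}F_k(x)\le C(\Delta_n(x))^\alpha\qquad\text{for all }x\in[0,1]\text{ and }n\ge1.$$
   Context: $\Delta_n(x)=\max\{\sqrt{x(1-x)/n},\,1/n\}$. $\mathcal{B}^+_n$ is the cone of polynomials of the form $\sum_{k=0}^n c_k\binom nk x^k(1-x)^{n-k}$ with all $c_k\ge0$. For non-integer $\alpha>0$ let $r=\lfloor\alpha\rfloor$; $f\in C^\alpha[0,1]$ means that $f$ is $r$ times differentiable on $[0,1]$ and $\sup_{x,y\in[0,1],|x-y|<h}|f^{(r)}(x)-f^{(r)}(y)|=O(h^{\alpha-r})$. *)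

(* Defs.v *)
From HB Require Import structures.
From mathcomp Require Import all_boot all_order all_algebra.
From mathcomp Require Import all_classical all_reals all_analysis.

Set Implicit Arguments.
Unset Strict Implicit.
Unset Printing Implicit Defensive.

Import Order.TTheory GRing.Theory Num.Theory.
Import numFieldNormedType.Exports.

Local Open Scope classical_set_scope.
Local Open Scope ring_scope.

Definition Delta (R : realType) (n : nat) (x : R) : R :=
  Num.max (Num.sqrt (x * (1 - x) / n%:R)) (n%:R^-1).

Definition bernstein_cone (R : realType) (n : nat) : set {poly R} :=
  [set p | exists2 c : 'I_n.+1 -> R, (forall k, 0 <= c k) &
     p = \sum_(k < n.+1) (c k * 'C(n, k)%:R) *: ('X^k * (1 - 'X) ^+ (n - k))].

(* Functions on [0, 1] are represented by total functions R -> R.  The limits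
   below are taken through points of [0, 1] only, so that derivatives are
   one-sided at 0 and 1 and values outside [0, 1] play no role. *)
Definition diffquot01 (R : realType) (f : R -> R) (x y : R) : R :=
  (f y - f x) / (y - x).

Definition derivable01 (R : realType) (f : R -> R) (x : R) : Prop :=
  cvg (diffquot01 f x y @[y --> within `[0, 1] x^']).

Definition derive01 (R : realType) (f : R -> R) (x : R) : R :=
  lim (diffquot01 f x y @[y --> within `[0, 1] x^']).

Definition derive01n (R : realType) (k : nat) (f : R -> R) : R -> R :=
  iter k (@derive01 R) f.

Definition derivable01n (R : realType) (r : nat) (f : R -> R) : Prop :=
  forall k, (k < r)%N -> forall x, x \in `[0, 1] ->
    derivable01 (derive01n k f) x.

(* The supremum is taken in \bar R because a supremum of an unbounded set in R
   would be the junk value 0. *)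
Definition modulus01 (R : realType) (g : R -> R) (h : R) : \bar R :=
  ereal_sup [set z | exists x y, [/\ x \in `[0, 1], y \in `[0, 1],
    `|x - y| < h & z = `|g x - g y|%:E]].

(* Meant for alpha > 0 non-integer; Num.truncn alpha is then its floor, as a
   natural number.  The bound is O(h `^ (alpha - r)) as h tends to 0+. *)
Definition holder01 (R : realType) (alpha : R) (f : R -> R) : Prop :=
  let r := Num.truncn alpha in
  derivable01n r f /\
  exists K : R, \forall h \near 0^'+,
    (modulus01 (derive01n r f) h <= (K * h `^ (alpha - r%:R))%:E)%E.

(* Main.v *)
Require Import Defs.
From HB Require Import structures.
From mathcomp Require Import all_boot all_order all_algebra.
From mathcomp Require Import all_classical all_reals all_analysis.
From mathcomp Require Import cyclic separable cyclotomic complex.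
From mathcomp Require Import ring lra zify.

Set Implicit Arguments.
Unset Strict Implicit.
Unset Printing Implicit Defensive.

Import Order.TTheory GRing.Theory Num.Theory.
Import numFieldNormedType.Exports.

Local Open Scope classical_set_scope.
Local Open Scope ring_scope.

(** Write Delta for Delta_n(x); it is the width of the Bernstein kernel of
degree n at x, and it is the only scale in the proof.

From smoothness to the series.  With x_l = l/n, give the quasi-interpolant of
degree n the Bernstein coefficients [bcoef n l (taylor r F x_l)], that is, the
l-th Bernstein coefficients of the Taylor polynomials of f at x_l.  It
reproduces polynomials of degree at most r, so its error at x, and also the
difference between its coefficients in a higher degree M and those of the
quasi-interpolant of degree M, involve only Taylor remainders, averaged over a
probability distribution on the points l/n ([quasi_interp_error]).  For the error the
distribution is binomial; for coefficients in degree M it is hypergeometric,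
and it is at most as spread out ([bcoef_ell_le]).  Both have width Delta
([concentrated_moment]), whence a bound C Delta^alpha in both cases.  The cone
polynomial [Delta_poly alpha n] is comparable to Delta^alpha, and so are its
coefficients in every higher degree ([Delta_poly_bounds]).  Passing from n to
q n with q large makes Delta^alpha drop by a large constant factor, so
subtracting a large multiple of [Delta_poly alpha n] from the
quasi-interpolants makes them increase, in the order of the cone, along the
degrees n0 q^j ([approximants]).  For n0 large the first one lies in the cone,
because f is bounded below by a positive constant.  The increments are the
terms of the series.

From the series to smoothness.  A polynomial of the cone of degree n that is
at most K Delta^alpha has i-th derivative at most C K Delta^(alpha - i)
([cone_deriv_le]).  This is Cauchy's estimate on the circle of radius Delta
around x: since the Bernstein coefficients are nonnegative, the modulus at z
is at most (|z| + |1 - z|)^n times the value at the real point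
|z| / (|z| + |1 - z|), and |z| + |1 - z| <= 1 + 2/n on that circle.  Grouping
the series into dyadic blocks, the derivatives of order at most r converge
geometrically.  For the increment of the r-th derivative over a distance h,
the blocks with Delta >= h are bounded by the derivative of order r + 1 and
the others by the r-th derivative itself; the two sums are geometric and each
is of order h^(alpha - r) ([increment_le], [telescope_holder]). *)

(** * Bernstein coefficients as linear functionals *)

Definition bern {R : numFieldType} (n k : nat) : {poly R} :=
  'C(n, k)%:R *: ('X^k * (1 - 'X) ^+ (n - k)).

(** The functional that reads off the k-th coefficient in the Bernstein basis of
degree n, given by its values C(k,i) / C(n,i) on the monomials X^i.  Stated
this way it is linear on all polynomials; it has this meaning when the degree
is at most n. *)
Definition bcoef {R : numFieldType} (n k : nat) (p : {poly R}) : R :=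
  \sum_(i < n.+1) p`_i * ('C(k, i)%:R / 'C(n, i)%:R).

Lemma bcoef_is_scalar {R : numFieldType} n k : scalar (@bcoef R n k).
Proof.
move=> a p q; rewrite /bcoef mulr_sumr -big_split /=.
by apply: eq_bigr => i _; rewrite coefD coefZ mulrDl mulrA.
Qed.

HB.instance Definition _ (R : numFieldType) n k :=
  GRing.isLinear.Build R {poly R} R *%R (@bcoef R n k) (@bcoef_is_scalar R n k).

Lemma bcoefZ {R : numFieldType} n k a (p : {poly R}) :
  bcoef n k (a *: p) = a * bcoef n k p.
Proof. exact: linearZ. Qed.

Lemma bcoef_sum {R : numFieldType} n k (I : Type) (r : seq I) (P : pred I)
    (F : I -> {poly R}) :
  bcoef n k (\sum_(i <- r | P i) F i) = \sum_(i <- r | P i) bcoef n k (F i).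
Proof. exact: linear_sum. Qed.

Lemma bcoefXn {R : numFieldType} n k i :
  bcoef n k 'X^i = 'C(k, i)%:R / 'C(n, i)%:R :> R.
Proof.
rewrite /bcoef; have [lein|ltni] := leqP i n.
  rewrite (bigD1 (Ordinal (lein : (i < n.+1)%N))) //= coefXn eqxx mul1r big1 ?addr0 //.
  by move=> j; rewrite -val_eqE /= coefXn => /negPf->; rewrite mul0r.
rewrite (bin_small ltni) invr0 mulr0 big1 // => j _.
by rewrite coefXn ltn_eqF ?mul0r // (leq_trans (ltn_ord j)).
Qed.

Lemma bcoef1 {R : numFieldType} n k : bcoef n k 1 = 1 :> R.
Proof. by have := @bcoefXn R n k 0; rewrite expr0 !bin0 divr1. Qed.

Lemma poly_sumXn {R : numFieldType} m (p : {poly R}) : (size p <= m)%N ->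
  p = \sum_(i < m) p`_i *: 'X^i.
Proof.
move=> sp; rewrite -(poly_def m (fun i => p`_i)); apply/polyP => i; rewrite coef_poly.
by case: ltnP => // mi; rewrite nth_default // (leq_trans sp).
Qed.

Lemma binr_neq0 {R : numFieldType} n i : (i <= n)%N -> 'C(n, i)%:R != 0 :> R.
Proof. by move=> le_in; rewrite pnatr_eq0 -lt0n bin_gt0. Qed.

Lemma size_bern {R : numFieldType} n k : (k <= n)%N -> (size (@bern R n k) <= n.+1)%N.
Proof.
move=> lekn; apply: leq_trans (size_scale_leq _ _) _.
apply: leq_trans (size_polyMleq _ _) _; rewrite size_polyXn /=.
apply: leq_trans (_ : (k + (n - k).+1 <= _)%N); last by lia.
rewrite leq_add2l; apply: leq_trans (size_poly_exp_leq _ _) _.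
rewrite (_ : size _ = 2%N) ?mul1n //.
by rewrite -opprB size_polyN size_XsubC.
Qed.

Lemma sum_bern {R : numFieldType} n : \sum_(k < n.+1) bern n k = 1 :> {poly R}.
Proof.
have := exprDn (1 - 'X : {poly R}) 'X n; rewrite subrK expr1n => ->.
by apply: eq_bigr => k _; rewrite /bern mulrC scaler_nat.
Qed.

Lemma bin_trinomial n i k : (i + k <= n)%N ->
  ('C(k + i, i) * 'C(n, k + i) = 'C(n, i) * 'C(n - i, k))%N.
Proof.
move=> le_n.
have h1 := @bin_fact n i ltac:(lia); have h2 := @bin_fact (n - i) k ltac:(lia).
have h3 := @bin_fact n (k + i) ltac:(lia); have h4 := @bin_fact (k + i) i ltac:(lia).
have e1 : (n - i - k = n - (k + i))%N by lia.
rewrite e1 in h2; rewrite addnK in h4.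
have f_gt0 : (0 < i`! * (k`! * (n - (k + i))`!))%N by rewrite !muln_gt0 !fact_gt0.
apply/eqP; rewrite -(eqn_pmul2r f_gt0); apply/eqP.
transitivity n`!; first by rewrite -h3 -h4; ring.
by rewrite -h1 -h2; ring.
Qed.

(** Multiply X^i by (X + (1 - X))^(n - i). *)
Lemma bern_expansion {R : numFieldType} n (p : {poly R}) : (size p <= n.+1)%N ->
  p = \sum_(k < n.+1) bcoef n k p *: bern n k.
Proof.
move=> sp.
have H (i : 'I_n.+1) : 'X^i = \sum_(k < n.+1) bcoef n k 'X^i *: bern n k :> {poly R}.
  have le_in : (i <= n)%N by rewrite -ltnS.
  rewrite -(big_mkord xpredT (fun k => bcoef n k 'X^i *: bern n k)).
  rewrite (big_cat_nat (leq0n i) (ltnW (ltn_ord i))) /= big_nat_cond big1 ?add0r; last first.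
    by move=> k /andP[/andP[_ ltki] _]; rewrite bcoefXn bin_small // mul0r scale0r.
  rewrite -{2}[val i]add0n big_addn subSn // big_mkord.
  rewrite -{1}['X^i]mulr1 -(sum_bern (n - i)) mulr_sumr; apply: eq_bigr => k _.
  have lekn : (k <= n - i)%N by rewrite -ltnS.
  rewrite bcoefXn /bern -scalerAr scalerA mulrA -exprD [(i + k)%N]addnC.
  have -> : (n - i - k)%N = (n - (k + i))%N by lia.
  congr (_ *: _).
  have le_n : (i + k <= n)%N by lia.
  rewrite mulrAC -natrM (bin_trinomial le_n) natrM.
  by rewrite mulrAC mulfV ?mul1r ?binr_neq0.
rewrite {1}(poly_sumXn sp).
under eq_bigr do rewrite H scaler_sumr.
rewrite exchange_big /=; apply: eq_bigr => k _.
rewrite {2}(poly_sumXn sp) bcoef_sum scaler_suml. apply: eq_bigr => i _.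
by rewrite /= bcoefZ scalerA.
Qed.

Lemma bcoef_MX {R : numFieldType} n k (p : {poly R}) : (size p <= n.+1)%N ->
  bcoef n.+1 k ('X * p) = k%:R / n.+1%:R * bcoef n k.-1 p.
Proof.
move=> sp; rewrite (poly_sumXn sp) mulr_sumr !bcoef_sum mulr_sumr.
apply: eq_bigr => i _; rewrite -scalerAr -exprS /= !bcoefZ !bcoefXn [RHS]mulrCA; congr (_ * _).
have le_in : (i <= n)%N by rewrite -ltnS.
have := mul_bin_diag k i; have := mul_bin_diag n.+1 i; rewrite /= => hn hk.
have hn' : n.+1%:R * 'C(n, i)%:R = i.+1%:R * 'C(n.+1, i.+1)%:R :> R by rewrite -!natrM hn.
have hk' : k%:R * 'C(k.-1, i)%:R = i.+1%:R * 'C(k, i.+1)%:R :> R by rewrite -!natrM hk.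
have n0 : n.+1%:R != 0 :> R by rewrite pnatr_eq0.
have i0 : i.+1%:R != 0 :> R by rewrite pnatr_eq0.
have c0 := @binr_neq0 R n i le_in; have c1 := @binr_neq0 R n.+1 i.+1 le_in.
by apply/eqP; rewrite mulf_div hn' hk' eqr_div ?mulf_neq0 //; apply/eqP; ring.
Qed.

Lemma bcoef_M1X {R : numFieldType} n k (p : {poly R}) : (size p <= n.+1)%N ->
  bcoef n.+1 k ((1 - 'X) * p) = (1 - k%:R / n.+1%:R) * bcoef n k p.
Proof.
move=> sp; rewrite mulrBl mul1r raddfB /= bcoef_MX // (poly_sumXn sp) !bcoef_sum !mulr_sumr.
rewrite -sumrB; apply: eq_bigr => i _; rewrite /= !bcoefZ !bcoefXn.
have le_in : (i <= n)%N by rewrite -ltnS.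
have hn' : n.+1%:R * 'C(n, i)%:R = (n.+1%:R - i%:R) * 'C(n.+1, i)%:R :> R.
  by rewrite -natrB ?leqW // -!natrM -mul_bin_down.
have hk' : k%:R * 'C(k.-1, i)%:R = (k%:R - i%:R) * 'C(k, i)%:R :> R.
  have [leik|ltki] := leqP i k; first by rewrite -natrB // -!natrM -mul_bin_down.
  by rewrite !bin_small ?mulr0 //; lia.
have n0 : n.+1%:R != 0 :> R by rewrite pnatr_eq0.
have c0 := @binr_neq0 R n i le_in; have c1 := @binr_neq0 R n.+1 i (leqW le_in).
set N1 := n.+1%:R in n0 hn' *.
set a := 'C(k, i)%:R in hk' *; set b := 'C(n.+1, i)%:R in hn' c1 *.
set c := 'C(n, i)%:R in hn' c0 *; set d := 'C(k.-1, i)%:R in hk' *.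
clearbody N1 a b c d.
have -> : b^-1 = (N1 - i%:R) / N1 / c.
  apply: (mulIf c1); rewrite mulVf //.
  transitivity ((N1 - i%:R) * b / (N1 * c)); first by rewrite -hn' mulfV ?mulf_neq0.
  by field; rewrite n0 c0.
have -> : k%:R / N1 * (p`_i * (d / c)) = p`_i * (k%:R * d) / N1 / c.
  by field; rewrite n0 c0.
by rewrite hk'; field; rewrite n0 c0.
Qed.

Lemma size_1BX {R : numFieldType} : size (1 - 'X : {poly R}) = 2%N.
Proof. by rewrite -opprB size_polyN size_XsubC. Qed.

Lemma size_XnM1X {R : numFieldType} a b :
  size ('X^a * (1 - 'X) ^+ b : {poly R}) = (a + b).+1.
Proof.
have u0 : (1 - 'X : {poly R}) != 0 by rewrite -size_poly_gt0 size_1BX.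
rewrite size_mul ?expf_neq0 ?polyX_eq0 // size_polyXn.
have : (0 < size ((1 - 'X : {poly R}) ^+ b))%N by rewrite size_poly_gt0 expf_neq0.
have := size_exp (1 - 'X : {poly R}) b; rewrite size_1BX.
case: (size ((1 - 'X) ^+ b)) => //= s -> _; by rewrite mul1n addnS.
Qed.

(** A factor X or 1 - X multiplies a coefficient of the remaining polynomial, in
one degree less, by k/n or by 1 - k/n. *)
Lemma bcoef_monomial_ge0 {R : numFieldType} n k a b : (k <= n)%N -> (a + b <= n)%N ->
  0 <= bcoef n k ('X^a * (1 - 'X) ^+ b : {poly R}).
Proof.
have frac_ge0 (k' m : nat) : 0 <= k'%:R / m%:R :> R by rewrite divr_ge0 ?ler0n.
elim: n a b k => [|n IHn] [|a] b k lekn leabn.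
- by have -> : b = 0%N by [lia]; rewrite mulr1 bcoefXn divr_ge0.
- by lia.
- case: b leabn => [|b] leabn; first by rewrite mulr1 bcoefXn divr_ge0.
  rewrite exprS mulrCA bcoef_M1X; last by rewrite size_XnM1X; lia.
  have [ltkn|] := ltnP k n.+1.
    apply: mulr_ge0; last by apply: IHn; lia.
    by rewrite subr_ge0 ler_pdivrMr ?ltr0n // mul1r ler_nat.
  move=> lenk; have -> : k = n.+1 by apply/eqP; rewrite eqn_leq lekn.
  by rewrite mulfV ?pnatr_eq0 // subrr mul0r.
- rewrite exprS -mulrA bcoef_MX; last by rewrite size_XnM1X; lia.
  by apply: mulr_ge0 => //; apply: IHn; lia.
Qed.

Lemma bcoef_bern_ge0 {R : numFieldType} n m k l : (k <= n)%N -> (l <= m <= n)%N ->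
  0 <= bcoef n k (@bern R m l).
Proof.
move=> lekn /andP[lelm lemn]; rewrite /bern bcoefZ mulr_ge0 ?ler0n //.
by apply: bcoef_monomial_ge0 => //; lia.
Qed.

(** The dual form of x (1 - x) b'(x) = (k - n x) b(x) for the k-th Bernstein
polynomial b of degree n.  It trades a factor X - k/n for a derivative and a
factor 1/n, and every estimate on central moments below comes from it. *)
Lemma bcoef_deriv {R : numFieldType} n k (p : {poly R}) : (size p <= n)%N ->
  n%:R * bcoef n k ('X * p) - k%:R * bcoef n k p
    + bcoef n k ('X * (1 - 'X) * p^`()) = 0.
Proof.
move=> sp; rewrite (poly_sumXn sp) ['X * _]mulr_sumr [(\sum_(_ < _) _)^`()]raddf_sum.
rewrite [_ * (1 - _) * _]mulr_sumr !bcoef_sum !mulr_sumr.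
rewrite -sumrB -big_split big1 //= => i _.
have ltin := ltn_ord i; have lein := ltnW ltin.
rewrite derivZ derivXn -!scalerAr -exprS /= !bcoefZ.
have -> : 'X * (1 - 'X) * ('X^(i.-1) *+ i) = i%:R *: ('X^i - 'X^(i.+1)) :> {poly R}.
  case: (nat_of_ord i) => [|j] /=; first by rewrite mulr0n mulr0 scale0r.
  by rewrite scaler_nat mulrnAr; congr (_ *+ _); rewrite !exprS; ring.
rewrite bcoefZ raddfB /= !bcoefXn.
have c0 := @binr_neq0 R n i lein; have c1 := @binr_neq0 R n i.+1 ltin.
have hn : i.+1%:R * 'C(n, i.+1)%:R = (n%:R - i%:R) * 'C(n, i)%:R :> R.
  by rewrite -natrB // -!natrM mul_bin_left.
have hk : i.+1%:R * 'C(k, i.+1)%:R = (k%:R - i%:R) * 'C(k, i)%:R :> R.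
  have [leik|ltki] := leqP i k; first by rewrite -natrB // -!natrM mul_bin_left.
  by rewrite !bin_small ?mulr0 //; lia.
have i0 : i.+1%:R != 0 :> R by rewrite pnatr_eq0.
have ni0 : n%:R - i%:R != 0 :> R by rewrite -natrB // pnatr_eq0; lia.
have -> : 'C(k, i.+1)%:R / 'C(n, i.+1)%:R =
    (k%:R - i%:R) / (n%:R - i%:R) * ('C(k, i)%:R / 'C(n, i)%:R) :> R.
  by apply/eqP; rewrite mulf_div -hn -hk eqr_div ?mulf_neq0 //; apply/eqP; ring.
by field; rewrite c0.
Qed.

(** * The scale Delta and concentration of the Bernstein weights *)

Lemma powR_sqr {R : realType} (y g : R) : 0 <= y -> y `^ g = (y ^+ 2) `^ (g / 2).
Proof.
move=> y0; rewrite -powR_mulrn // -powRrM; congr (_ `^ _).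
by rewrite mulrCA mulfV ?mulr1.
Qed.

Lemma powR_small {R : realType} (b K e : R) : 0 < b -> 0 <= K -> 0 < e ->
  exists2 d, 0 < d & forall t, 0 <= t -> t < d -> K * t `^ b <= e.
Proof.
move=> b0 K0 e0; have K1 : 0 < K + 1 by rewrite ltr_wpDl.
exists ((e / (K + 1)) `^ b^-1); first by rewrite powR_gt0 // divr_gt0.
move=> t t0 td; apply: (@le_trans _ _ ((K + 1) * t `^ b)).
  by rewrite ler_wpM2r ?powR_ge0 // lerDl.
rewrite mulrC -ler_pdivlMr //.
have -> : e / (K + 1) = ((e / (K + 1)) `^ b^-1) `^ b.
  by rewrite -powRrM mulVf ?gt_eqF // powRr1 // ltW // divr_gt0.
by apply: ge0_ler_powR; rewrite ?nnegrE ?powR_ge0 // ltW.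
Qed.

Lemma Delta_gt0 {R : realType} n (x : R) : (0 < n)%N -> 0 < Delta n x.
Proof. by move=> n0; rewrite lt_max invr_gt0 ltr0n n0 orbT. Qed.

Lemma Delta_ge_inv {R : realType} n (x : R) : n%:R^-1 <= Delta n x.
Proof. by rewrite le_max lexx orbT. Qed.

Lemma Delta_sq {R : realType} n (x : R) : 0 <= x <= 1 ->
  Delta n x ^+ 2 = Num.max (x * (1 - x) / n%:R) (n%:R^-1 ^+ 2).
Proof.
move=> /andP[x0 x1]; rewrite /Delta.
have w0 : 0 <= x * (1 - x) / n%:R by rewrite divr_ge0 ?mulr_ge0 // subr_ge0.
have i0 : 0 <= n%:R^-1 :> R by rewrite invr_ge0.
rewrite -{2}(sqr_sqrtr w0).
have [le1|lt1] := leP (Num.sqrt (x * (1 - x) / n%:R)) n%:R^-1.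
  by rewrite max_r // ler_pXn2r // nnegrE sqrtr_ge0.
by rewrite max_l // ler_pXn2r ?nnegrE ?sqrtr_ge0 // ltW.
Qed.

Lemma Delta_sq_le {R : realType} n (x : R) : (0 < n)%N -> 0 <= x <= 1 ->
  Delta n x ^+ 2 <= n%:R^-1.
Proof.
move=> n0 x01; rewrite Delta_sq // ge_max; apply/andP; split.
  rewrite -[leRHS]mul1r ler_wpM2r ?invr_ge0 //.
  by move: x01 => /andP[? ?]; nra.
rewrite expr2 -[leRHS]mulr1 ler_wpM2l ?invr_ge0 // invf_le1 ?ltr0n // ler1n.
exact: n0.
Qed.

Lemma Delta_le1 {R : realType} n (x : R) : (0 < n)%N -> 0 <= x <= 1 -> Delta n x <= 1.
Proof.
move=> n0 x01; rewrite -(@ler_pXn2r _ 2) ?nnegrE ?ler01 //; last exact/ltW/Delta_gt0.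
rewrite expr1n (le_trans (Delta_sq_le n0 x01)) // invf_le1 ?ltr0n // ler1n.
exact: n0.
Qed.

Lemma var_le_Delta_sq {R : realType} n (x : R) : 0 <= x <= 1 ->
  x * (1 - x) / n%:R <= Delta n x ^+ 2.
Proof. by move=> x01; rewrite Delta_sq // le_max lexx. Qed.

(** x (1 - x) is 1-Lipschitz on the unit interval. *)
Lemma Delta_sq_dist {R : realType} n (x y : R) : (0 < n)%N ->
  0 <= x <= 1 -> 0 <= y <= 1 ->
  Delta n y ^+ 2 <= Delta n x ^+ 2 + `|x - y| / n%:R.
Proof.
move=> n0 x01 y01; rewrite [leLHS]Delta_sq // ge_max; apply/andP; split.
  apply: le_trans (lerD (var_le_Delta_sq n x01) (lexx _)).
  rewrite -mulrDl ler_wpM2r ?invr_ge0 //.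
  move: x01 y01 => /andP[? ?] /andP[? ?].
  by case: (ler0P (x - y)) => h; nra.
by rewrite Delta_sq // -[leLHS]addr0 lerD ?le_max ?lexx ?orbT // divr_ge0.
Qed.

(** Delta varies by a bounded factor over distances comparable to itself. *)
Lemma Delta_ratio {R : realType} n (x y : R) : (0 < n)%N ->
  0 <= x <= 1 -> 0 <= y <= 1 ->
  Delta n y <= Delta n x * (1 + `|y - x| / Delta n x) /\
  Delta n x <= Delta n y * (1 + `|y - x| / Delta n x).
Proof.
move=> n0 x01 y01.
have dx0 := Delta_gt0 x n0; have dy0 := Delta_gt0 y n0.
have hx := Delta_sq_dist n0 x01 y01; have hy := Delta_sq_dist n0 y01 x01.
have ix := Delta_ge_inv n x; have iy := Delta_ge_inv n y.
rewrite distrC in hx.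
set d := `|y - x| in hx hy *; have d0 : 0 <= d by exact: normr_ge0.
set a := Delta n x in dx0 hx hy ix *; set b := Delta n y in dy0 hx hy iy *.
set t := n%:R^-1 in hx hy ix iy; have t0 : 0 <= t by rewrite invr_ge0.
have e : d = d / a * a by rewrite mulfVK // gt_eqF.
have s0 : 0 <= d / a by rewrite divr_ge0 // ltW.
move: (d / a) e s0 => s e s0.
have {}hx : b ^+ 2 <= a ^+ 2 * (1 + s) by nra.
have {}hy : a ^+ 2 <= b ^+ 2 + s * a * b by nra.
split; rewrite leNgt; apply/negP => h; first by nra.
have : b < a by nra.
by nra.
Qed.

Lemma Delta_degree_anti {R : realType} n m (x : R) : (0 < n <= m)%N -> 0 <= x <= 1 ->
  Delta m x ^+ 2 <= n%:R / m%:R * Delta n x ^+ 2.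
Proof.
move=> /andP[n0 nm] x01; have m0 := leq_trans n0 nm.
have nR : 0 < n%:R :> R by rewrite ltr0n.
have mR : 0 < m%:R :> R by rewrite ltr0n.
have le_nm : n%:R <= m%:R :> R by rewrite ler_nat.
rewrite [Delta m x ^+ 2]Delta_sq // ge_max; apply/andP; split.
  apply: le_trans (ler_wpM2l _ (var_le_Delta_sq n x01)); last by rewrite divr_ge0.
  by rewrite le_eqVlt; apply/orP; left; apply/eqP; field; rewrite !gt_eqF.
apply: (@le_trans _ _ (n%:R / m%:R * n%:R^-1 ^+ 2)).
  rewrite expr2 [X in _ <= X](_ : _ = m%:R^-1 * n%:R^-1); last first.
    by field; rewrite !gt_eqF.
  apply: ler_wpM2l; first by rewrite invr_ge0.
  by rewrite lef_pV2 ?posrE.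
apply: ler_wpM2l; first by rewrite divr_ge0.
by rewrite Delta_sq // le_max lexx orbT.
Qed.

Lemma Delta_degree_mono {R : realType} n m (x : R) : (0 < n <= m)%N -> 0 <= x <= 1 ->
  Delta n x <= m%:R / n%:R * Delta m x.
Proof.
move=> /andP[n0 nm] x01; have m0 := leq_trans n0 nm.
have nR : 0 < n%:R :> R by rewrite ltr0n.
have mR : 0 < m%:R :> R by rewrite ltr0n.
have le_nm : n%:R <= m%:R :> R by rewrite ler_nat.
have q1 : 1 <= m%:R / n%:R :> R by rewrite ler_pdivlMr ?mul1r.
have q0 : 0 <= m%:R / n%:R :> R by rewrite divr_ge0.
rewrite -(@ler_pXn2r _ 2) ?nnegrE ?mulr_ge0 //; try exact/ltW/Delta_gt0.
rewrite [leLHS]Delta_sq // ge_max exprMn; apply/andP; split.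
  apply: le_trans (ler_wpM2l _ (var_le_Delta_sq m x01)); last by rewrite exprn_ge0.
  rewrite [X in _ <= X](_ : _ = m%:R / n%:R * (x * (1 - x) / n%:R)); last first.
    by field; rewrite !gt_eqF.
  rewrite -[leLHS]mul1r; apply: ler_wpM2r => //.
  by case/andP: x01 => x0 x1; rewrite divr_ge0 ?mulr_ge0 ?subr_ge0.
apply: (@le_trans _ _ ((m%:R / n%:R) ^+ 2 * m%:R^-1 ^+ 2)).
  by rewrite -exprMn mulrAC mulfV ?mul1r // gt_eqF.
apply: ler_wpM2l; first by rewrite exprn_ge0.
by rewrite Delta_sq // le_max lexx orbT.
Qed.

(** The n-th power of this affine function is the generating function of the
Bernstein polynomials of degree n. *)
Definition ell {R : numFieldType} (u v : R) : {poly R} := u *: (1 - 'X) + v *: 'X.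

Lemma ell_exp {R : numFieldType} (u v : R) n :
  ell u v ^+ n = \sum_(l < n.+1) (u ^+ (n - l) * v ^+ l) *: bern n l.
Proof.
rewrite /ell exprDn; apply: eq_bigr => l _.
rewrite !exprZn -scalerAl -scalerAr scalerA /bern [X in _ = _ *: X]scaler_nat.
by rewrite scalerMnr ['X^l * _]mulrC.
Qed.

Lemma size_ell_exp {R : numFieldType} (u v : R) n : (size (ell u v ^+ n) <= n.+1)%N.
Proof.
rewrite (leq_trans (size_poly_exp_leq _ _)) // ltnS -[leqRHS]mul1n leq_mul2r.
apply/orP; right; rewrite -subn1 leq_subLR (leq_trans (size_polyD _ _)) // geq_max.
by rewrite !(leq_trans (size_scale_leq _ _)) ?size_1BX ?size_polyX.
Qed.

Lemma deriv_ell {R : numFieldType} (u v : R) : (ell u v)^`() = (v - u)%:P.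
Proof.
rewrite /ell derivD !derivZ derivB derivX -polyC1 derivC sub0r -!mul_polyC polyCB.
by rewrite mulrN mulr1 addrC mulr1.
Qed.

Lemma horner_ell {R : numFieldType} (u v x : R) : (ell u v).[x] = u * (1 - x) + v * x.
Proof. by rewrite /ell !hornerE. Qed.

Lemma bcoef_varell_ge0 {R : realFieldType} M k n (u v : R) : (k <= M)%N ->
  (n.+2 <= M)%N -> 0 <= u -> 0 <= v ->
  0 <= bcoef M k ('X * (1 - 'X) * ell u v ^+ n).
Proof.
move=> lekM ltnM u0 v0; rewrite ell_exp mulr_sumr bcoef_sum sumr_ge0 // => l _.
have lelm := ltn_ord l.
rewrite -scalerAr bcoefZ mulr_ge0 ?mulr_ge0 ?exprn_ge0 //.
rewrite /bern -scalerAr bcoefZ mulr_ge0 //.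
rewrite mulrACA -exprS -exprS bcoef_monomial_ge0 //; lia.
Qed.

(** The coefficients of bern n l in degree M are the probabilities of drawing l
marked balls when n balls are drawn without replacement from M balls of which
k are marked; drawing with replacement gives the value at k/M.  So the
exponential moments without replacement are at most those with replacement.
With A_n the left-hand side, bcoef_deriv gives A_(n+1) = ell(k/M) A_n minus
(v - u)^2 (n/M) times a nonnegative coefficient. *)
Lemma bcoef_ell_le {R : realFieldType} M k n (u v : R) : (0 < M)%N -> (k <= M)%N ->
  (n <= M)%N -> 0 <= u -> 0 <= v ->
  bcoef M k (ell u v ^+ n) <= (ell u v).[k%:R / M%:R] ^+ n.
Proof.
move=> M0 lekM + u0 v0; set x := k%:R / M%:R.
have MR : 0 < M%:R :> R by rewrite ltr0n.
have x0 : 0 <= x by rewrite divr_ge0.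
have x1 : x <= 1 by rewrite ler_pdivrMr // mul1r ler_nat.
have ell0 : 0 <= (ell u v).[x] by rewrite horner_ell addr_ge0 ?mulr_ge0 ?subr_ge0.
elim: n => [_|n IHn ltnM].
  by rewrite !expr0 bcoef1.
have size_p : (size (ell u v ^+ n) <= M)%N by rewrite (leq_trans (size_ell_exp _ _ _)).
have := bcoef_deriv k size_p.
rewrite deriv_exp deriv_ell mul_polyC scalerMnl -scalerAr bcoefZ.
set A := bcoef M k (ell u v ^+ n); set B := bcoef M k ('X * _); set D := bcoef M k _ => hd.
have nD : 0 <= n%:R * D.
  case: n @D {IHn size_p A B hd} ltnM => [|n] D ltnM; first by rewrite mul0r.
  by rewrite mulr_ge0 // bcoef_varell_ge0.
have -> : ell u v ^+ n.+1 =
    (ell u v).[0] *: ell u v ^+ n + (v - u) *: ('X * ell u v ^+ n).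
  rewrite exprS horner_ell subr0 mulr1 mulr0 addr0; set P := ell u v ^+ n.
  by rewrite /ell -!mul_polyC polyCB; ring.
have -> : bcoef M k ((ell u v).[0] *: ell u v ^+ n + (v - u) *: ('X * ell u v ^+ n))
   = u * A + (v - u) * B.
  by rewrite raddfD /= !bcoefZ horner_ell subr0 mulr1 mulr0 addr0.
have eB : B = x * A - (v - u) * (n%:R * D) / M%:R.
  apply: (mulfI (lt0r_neq0 MR)); rewrite /x mulrBr.
  have -> : M%:R * (k%:R / M%:R * A) = k%:R * A by field; rewrite gt_eqF.
  have -> : M%:R * ((v - u) * (n%:R * D) / M%:R) = (v - u) *+ n * D.
    by rewrite -mulr_natr; field; rewrite gt_eqF.
  by move/eqP: hd; rewrite addrAC subr_eq0 => /eqP <-; rewrite addrK.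
apply: (@le_trans _ _ ((ell u v).[x] * A)); last by rewrite exprS ler_wpM2l // IHn // ltnW.
rewrite horner_ell eB.
have : 0 <= (v - u) ^+ 2 * (n%:R * D) / M%:R 
  by apply: divr_ge0 => //; apply: mulr_ge0 => //; exact: sqr_ge0.
by nra.
Qed.

(** The properties common to evaluation at x and to the coefficient functionals
bcoef M k with k/M = x and n <= M: the numbers L (bern n l) form a probability
distribution on the points l/n whose exponential moments are at most those of
the binomial law of parameter x.  Working with such an L treats pointwise
errors and coefficients in a higher degree at the same time. *)
Definition concentrated {R : realFieldType} (n : nat) (x : R)
    (L : {scalar {poly R}}) : Prop :=
  (forall l, (l <= n)%N -> 0 <= L (bern n l)) /\
  (L 1 = 1 /\ forall u v, 0 <= u -> 0 <= v -> L (ell u v ^+ n) <= (ell u v).[x] ^+ n).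

Lemma concentrated_bcoef {R : realFieldType} n M k : (0 < M)%N -> (n <= M)%N ->
  (k <= M)%N -> concentrated n (k%:R / M%:R : R) (bcoef M k).
Proof.
move=> M0 lenM lekM; split; first by move=> l leln; rewrite bcoef_bern_ge0 // leln.
split; last by move=> u v u0 v0; exact: bcoef_ell_le.
exact: bcoef1.
Qed.

Lemma horner_bern_ge0 {R : realFieldType} n k (x : R) : 0 <= x <= 1 ->
  0 <= (bern n k).[x].
Proof.
move=> /andP[x0 x1]; rewrite /bern hornerZ hornerM horner_exp hornerX horner_exp !hornerE.
by rewrite !mulr_ge0 ?exprn_ge0 ?subr_ge0.
Qed.

Lemma concentrated_horner {R : realFieldType} n (x : R) : 0 <= x <= 1 ->
  concentrated n x (horner_eval x).
Proof.
move=> x01; split; first by move=> l _; exact: horner_bern_ge0.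
by split=> [|u v _ _]; rewrite /= /horner_eval ?hornerE ?horner_exp.
Qed.

(** For |s| <= 1/2 the inequality exp(s) (1 - s) <= 1 gives
exp(s) <= 1 + s + 2 s^2; take s = t/2 and square. *)
Lemma expR_le_quadratic {R : realType} (t : R) : `|t| <= 1 ->
  expR t <= 1 + t + 2 * t ^+ 2.
Proof.
rewrite ler_norml => /andP[t1 t2].
suff half : expR (t / 2) <= 1 + t / 2 + t ^+ 2 / 2.
  have -> : t = t / 2 + t / 2 by lra.
  rewrite expRD; apply: (@le_trans _ _ ((1 + t / 2 + t ^+ 2 / 2) ^+ 2)).
    by rewrite expr2 ler_pM // expR_ge0.
  rewrite -subr_ge0.
  have -> : 1 + (t / 2 + t / 2) + 2 * (t / 2 + t / 2) ^+ 2 -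
    (1 + t / 2 + t ^+ 2 / 2) ^+ 2 = t ^+ 2 / 4 * ((1 - t) * (3 + t)) by field.
  have ? : 0 <= 1 - t by lra.
  have ? : 0 <= 3 + t by lra.
  by apply: mulr_ge0; [rewrite divr_ge0 ?sqr_ge0|apply: mulr_ge0].
have pos : 0 < 1 - t / 2 by lra.
have : expR (t / 2) * (1 - t / 2) <= 1.
  rewrite -[leRHS](expRxMexpNx_1 (t / 2)); apply: ler_wpM2l; first exact: expR_ge0.
  exact: (expR_ge1Dx (- (t / 2))).
rewrite -ler_pdivlMr // => /le_trans; apply.
rewrite ler_pdivrMr //; nra.
Qed.

(** A single draw has centred exponential moment at most
1 + 2 t^2 x (1 - x), and n x (1 - x) <= (n Delta)^2. *)
Lemma concentrated_expR_le {R : realType} n (x t : R) (L : {scalar {poly R}}) :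
  (0 < n)%N -> 0 <= x <= 1 -> `|t| * (n%:R * Delta n x) <= 1 ->
  concentrated n x L ->
  \sum_(l < n.+1) L (bern n l) * expR (t * (l%:R - n%:R * x)) <= expR 2.
Proof.
move=> n0 x01 tD [Lge0 [L1 Lell]].
have nR : 0 < n%:R :> R by rewrite ltr0n.
have nD1 : 1 <= n%:R * Delta n x.
  by rewrite -[leLHS](mulfV (lt0r_neq0 nR)); apply: ler_wpM2l (Delta_ge_inv _ _); exact: ltW.
have t1 : `|t| <= 1.
  by apply: le_trans tD; rewrite -[leLHS]mulr1 ler_wpM2l.
have [x0 x1] := andP x01.
set u := expR (- (t * x)); set v := expR (t * (1 - x)).
have -> : \sum_(l < n.+1) L (bern n l) * expR (t * (l%:R - n%:R * x)) =
    L (ell u v ^+ n).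
  rewrite ell_exp raddf_sum; apply: eq_bigr => l _ /=.
  rewrite [RHS]linearZ /= mulrC; congr (_ * _).
  rewrite /u /v -!expRM_natl -expRD; congr expR.
  by rewrite natrB; [ring|rewrite -ltnS].
apply: (le_trans (Lell _ _ (expR_ge0 _) (expR_ge0 _))).
rewrite horner_ell.
have hu : u <= 1 - t * x + 2 * (t * x) ^+ 2.
  have := @expR_le_quadratic R (- (t * x)); rewrite sqrrN; apply.
  by rewrite normrN normrM (ger0_norm x0) mulr_ile1.
have hv : v <= 1 + t * (1 - x) + 2 * (t * (1 - x)) ^+ 2.
  apply: expR_le_quadratic; have ? : 0 <= 1 - x by rewrite subr_ge0.
  by rewrite normrM (ger0_norm (x := 1 - x)) // mulr_ile1 // lerBlDr lerDl.
have huv : u * (1 - x) + v * x <= 1 + 2 * (t ^+ 2 * (x * (1 - x))).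
  apply: (@le_trans _ _ ((1 - t * x + 2 * (t * x) ^+ 2) * (1 - x) +
     (1 + t * (1 - x) + 2 * (t * (1 - x)) ^+ 2) * x)).
    by rewrite lerD // ler_wpM2r // subr_ge0.
  by rewrite le_eqVlt; apply/orP; left; apply/eqP; ring.
have w0 : 0 <= x * (1 - x) by rewrite mulr_ge0 // subr_ge0.
apply: (@le_trans _ _ (expR (2 * (t ^+ 2 * (x * (1 - x)))) ^+ n)).
  apply: lerXn2r; rewrite ?nnegrE ?expR_ge0 //.
    by rewrite addr_ge0 // mulr_ge0 ?expR_ge0 // subr_ge0.
  exact: le_trans huv (expR_ge1Dx _).
rewrite -expRM_natl ler_expR mulrCA -[leRHS]mulr1 ler_wpM2l //.
have hw := var_le_Delta_sq n x01.
apply: (@le_trans _ _ (t ^+ 2 * (n%:R * Delta n x) ^+ 2)).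
  rewrite mulrCA; apply: ler_wpM2l; first exact: sqr_ge0.
  rewrite exprMn expr2 -mulrA; apply: ler_wpM2l => //.
  by rewrite -ler_pdivrMl // mulrC.
by rewrite -real_normK ?num_real // -exprMn exprn_ile1 // mulr_ge0 // (le_trans ler01).
Qed.

Lemma concentrated_expR_dist_le {R : realType} n (x : R) (L : {scalar {poly R}}) :
  (0 < n)%N -> 0 <= x <= 1 -> concentrated n x L ->
  \sum_(l < n.+1) L (bern n l) * expR (`|l%:R / n%:R - x| / Delta n x) <=
    2 * expR 2.
Proof.
move=> n0 x01 Lc.
have nR : 0 < n%:R :> R by rewrite ltr0n.
have D0 := Delta_gt0 x n0.
set t := (n%:R * Delta n x)^-1.
have t0 : 0 <= t by rewrite invr_ge0 mulr_ge0 // ltW.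
have tD : `|t| * (n%:R * Delta n x) <= 1.
  by rewrite ger0_norm // mulVf // mulf_neq0 ?gt_eqF.
have tD' : `|- t| * (n%:R * Delta n x) <= 1 by rewrite normrN.
have H := lerD (concentrated_expR_le n0 x01 tD Lc) (concentrated_expR_le n0 x01 tD' Lc).
have -> : 2 * expR 2 = expR 2 + expR 2 :> R by ring.
apply: (le_trans _ H).
rewrite -big_split; apply: ler_sum => l _ /=.
rewrite -mulrDr; apply: ler_wpM2l; first by apply: (Lc.1); rewrite -ltnS.
have -> : `|l%:R / n%:R - x| / Delta n x = `|t * (l%:R - n%:R * x)|.
  rewrite normrM (ger0_norm t0) /t -[l%:R - _]/(l%:R - _).
  have -> : l%:R - n%:R * x = n%:R * (l%:R / n%:R - x) by field; rewrite gt_eqF.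
  by rewrite normrM (ger0_norm (ltW nR)); field; rewrite !gt_eqF.
case: (ler0P (t * (l%:R - n%:R * x))) => _; rewrite ?mulNr.
  by rewrite lerDr expR_ge0.
by rewrite lerDl expR_ge0.
Qed.

(** A power of 1 + s is at most a constant times exp(s), because
1 + s <= b exp(s / b) for b >= 1. *)
Lemma concentrated_moment {R : realType} n (x a : R) (L : {scalar {poly R}}) :
  (0 < n)%N -> 0 <= x <= 1 -> concentrated n x L -> 0 <= a ->
  \sum_(l < n.+1) L (bern n l) * (1 + `|l%:R / n%:R - x| / Delta n x) `^ a <=
    2 * expR 2 * (a + 1) `^ (a + 1).
Proof.
move=> n0 x01 Lc a0.
have D0 := Delta_gt0 x n0.
rewrite [leRHS]mulrC.
apply: (le_trans _ (ler_wpM2l (powR_ge0 _ _) (concentrated_expR_dist_le n0 x01 Lc))).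
rewrite mulr_sumr; apply: ler_sum => l _; rewrite mulrCA.
apply: ler_wpM2l; first by apply: (Lc.1); rewrite -ltnS.
set s := `|_| / _; have s0 : 0 <= s by rewrite divr_ge0 // ltW.
have b1 : 1 <= a + 1 by rewrite lerDr.
have b0 := lt_le_trans ltr01 b1.
apply: (@le_trans _ _ ((1 + s) `^ (a + 1))).
  by apply: ler_powR; rewrite ?lerDl // lerDl.
move: (a + 1) b1 b0 => b b1 b0.
have -> : expR s = expR (s / b) `^ b by rewrite -expRM mulfVK // gt_eqF.
rewrite -powRM ?expR_ge0 ?(ltW b0) //.
apply: ge0_ler_powR; rewrite ?nnegrE;
  [exact: ltW|exact: addr_ge0|by rewrite mulr_ge0 ?expR_ge0 ?ltW|].
apply: (@le_trans _ _ (b * (1 + s / b))); last first.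
  exact: (ler_wpM2l (ltW b0) (expR_ge1Dx _)).
by rewrite mulrDr mulr1 mulrCA mulfV ?gt_eqF // mulr1 lerD.
Qed.

(** * Quasi-interpolants built from Taylor polynomials *)

(** This is bcoef_deriv for a power of X - x, using
X (1 - X) = - (X - x)^2 + (1 - 2 x) (X - x) + x (1 - x). *)
Lemma bcoef_central_rec {R : numFieldType} n l i : (i.+1 < n)%N ->
  let x : R := l%:R / n%:R in
  (n%:R - i.+1%:R) * bcoef n l (('X - x%:P) ^+ i.+2) =
  - i.+1%:R * ((1 - 2 * x) * bcoef n l (('X - x%:P) ^+ i.+1) +
               x * (1 - x) * bcoef n l (('X - x%:P) ^+ i)).
Proof.
move=> ltin x.
have nR : n%:R != 0 :> R by rewrite pnatr_eq0; lia.
have size_p : (size (('X - x%:P) ^+ i.+1) <= n)%N by rewrite size_exp_XsubC.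
have := bcoef_deriv l size_p.
have -> : (('X - x%:P) ^+ i.+1)^`() = i.+1%:R *: ('X - x%:P) ^+ i.
  by rewrite deriv_exp derivXsubC mul1r scaler_nat.
rewrite -scalerAr bcoefZ.
have -> : 'X * (1 - 'X) * ('X - x%:P) ^+ i =
    - ('X - x%:P) ^+ i.+2 + (1 - 2 * x) *: ('X - x%:P) ^+ i.+1 +
    (x * (1 - x)) *: ('X - x%:P) ^+ i.
  rewrite -!mul_polyC !(polyCB, polyCM, polyC1, polyC_natr) !exprS.
  by move: (('X - x%:P) ^+ i) => q; ring.
have -> : 'X * ('X - x%:P) ^+ i.+1 = ('X - x%:P) ^+ i.+2 + x *: ('X - x%:P) ^+ i.+1.
  by rewrite -mul_polyC !exprS; ring.
rewrite !raddfD raddfN /= !bcoefZ.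
move: (bcoef n l _) (bcoef n l _) (bcoef n l _) => a2 a1 a0.
have -> : l%:R = n%:R * x by rewrite /x mulrC mulfVK.
move=> h; apply/eqP; rewrite -subr_eq0; apply/eqP; rewrite -[RHS]h; ring.
Qed.

(** By the recurrence, each new factor X - x contributes either 1/n, which is at
most Delta, or x (1 - x) / n, at most Delta^2, for two factors. *)
Lemma bcoef_central_le {R : realType} i : exists2 C : R, 0 <= C &
  forall n l, (0 < n)%N -> (i.*2 <= n)%N -> (l <= n)%N ->
  `|bcoef n l (('X - (l%:R / n%:R)%:P) ^+ i)| <= C * Delta n (l%:R / n%:R : R) ^+ i.
Proof.
pose P i (C : R) := forall n l, (0 < n)%N -> (i.*2 <= n)%N -> (l <= n)%N ->
  `|bcoef n l (('X - (l%:R / n%:R)%:P) ^+ i)| <= C * Delta n (l%:R / n%:R : R) ^+ i.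
suff [C C0 [HC _]] : exists2 C : R, 0 <= C & P i C /\ P i.+1 C by exists C.
elim: i => [|i [C C0 [HC HC1]]].
  exists 1 => //; split=> n l n0 ni leln; first by rewrite !expr0 bcoef1 normr1 mulr1.
  rewrite expr1 -[(_ / _)%:P]mulr1 mul_polyC raddfB /= bcoefZ bcoef1 (bcoefXn n l 1) !bin1.
  by rewrite mulr1 subrr normr0 mul1r expr1 ltW // Delta_gt0.
exists (4 * i.+1%:R * C + C); first by rewrite addr_ge0 ?mulr_ge0.
split=> n l n0 ni leln; have D0 := Delta_gt0 (l%:R / n%:R : R) n0.
  apply: le_trans (HC1 n l n0 ni leln) _.
  by rewrite ler_wpM2r ?exprn_ge0 ?(ltW D0) // lerDr !mulr_ge0.
have ltin : (i.+1 < n)%N by lia.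
have nR : 0 < n%:R :> R by rewrite ltr0n.
have x01 : 0 <= (l%:R / n%:R : R) <= 1.
  by rewrite divr_ge0 //= ler_pdivrMr // mul1r ler_nat.
have := @bcoef_central_rec R n l i ltin; rewrite /=.
have := HC1 n l n0 ltac:(lia) leln; have := HC n l n0 ltac:(lia) leln.
have := Delta_ge_inv n (l%:R / n%:R : R); have := var_le_Delta_sq n x01.
move: (l%:R / n%:R) x01 D0 => x /andP[x0 x1].
move: (Delta n x) (bcoef n l (_ ^+ i)) (bcoef n l (_ ^+ i.+1)) (bcoef n l (_ ^+ i.+2)).
move=> D a0 a1 a2 D0 hw hi h0 h1 h2.
have half : n%:R / 2 <= n%:R - i.+1%:R :> R.
  have : i.+1.*2%:R <= n%:R :> R by rewrite ler_nat (leq_trans _ ni) // leq_double.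
  by rewrite -muln2 natrM; lra.
have w0 : 0 <= x * (1 - x) by rewrite mulr_ge0 // subr_ge0.
have h3 : n%:R / 2 * `|a2| <= i.+1%:R * (C * D ^+ i.+1 + x * (1 - x) * (C * D ^+ i)).
  apply: (@le_trans _ _ ((n%:R - i.+1%:R) * `|a2|)); first by rewrite ler_wpM2r.
  have -> : (n%:R - i.+1%:R) * `|a2| = `|(n%:R - i.+1%:R) * a2|.
    by rewrite normrM ger0_norm //; apply: le_trans half; rewrite divr_ge0.
  rewrite h2 normrM normrN normr_nat; apply: ler_wpM2l => //.
  apply: (le_trans (ler_normD _ _)); rewrite (normrM (1 - _)) (normrM (x * _)).
  apply: lerD; last by rewrite (ger0_norm w0) ler_wpM2l.
  rewrite -[leRHS]mul1r ler_pM //.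
  by rewrite ler_norml; apply/andP; split; lra.
have hwn : x * (1 - x) <= n%:R * D ^+ 2 by rewrite -ler_pdivrMl // mulrC.
have hin : 1 <= n%:R * D by rewrite -ler_pdivrMl ?mulr1.
have h4 : n%:R / 2 * `|a2| <= n%:R / 2 * (4 * i.+1%:R * C * D ^+ i.+2).
  apply: (le_trans h3).
  have -> : n%:R / 2 * (4 * i.+1%:R * C * D ^+ i.+2) =
    i.+1%:R * ((n%:R * D) * (C * D ^+ i.+1) + n%:R * D ^+ 2 * (C * D ^+ i)).
    by rewrite !exprS; field.
  rewrite ler_wpM2l // lerD //; last by rewrite ler_wpM2r ?mulr_ge0 ?exprn_ge0 // ltW.
  by rewrite -[leLHS]mul1r ler_wpM2r ?mulr_ge0 ?exprn_ge0 // ltW.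
rewrite ler_pM2l in h4; last by rewrite divr_gt0.
apply: (le_trans h4); rewrite ler_wpM2r ?exprn_ge0 ?(ltW D0) // lerDl //.
Qed.

Definition taylor {R : realType} (r : nat) (F : nat -> R -> R) (y : R) : {poly R} :=
  \sum_(i < r.+1) (F i y / i`!%:R) *: ('X - y%:P) ^+ i.

Lemma size_taylor {R : realType} r F (y : R) : (size (taylor r F y) <= r.+1)%N.
Proof.
rewrite (leq_trans (size_sum _ _ _)) //; apply/bigmax_leqP => i _.
rewrite (leq_trans (size_scale_leq _ _)) // size_exp_XsubC.
exact: ltn_ord.
Qed.

(** Taylor's formula over {poly R}, evaluated at the point X. *)
Lemma poly_taylor {R : realType} m (p : {poly R}) (y : R) : (size p <= m)%N ->
  p = \sum_(i < m) (p^`(i).[y] / i`!%:R) *: ('X - y%:P) ^+ i.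
Proof.
move=> sp.
have sp' : (size (p^:P) <= m)%N by rewrite (leq_trans (size_poly _ _)).
have := nderiv_taylor_wide (mulrC y%:P ('X - y%:P)) sp'.
rewrite addrC subrK -/(p \Po 'X) comp_polyXr => {1}->.
apply: eq_bigr => i _; rewrite nderivn_map horner_map /= mul_polyC nderivn_def.
congr (_ *: _); rewrite hornerMn -mulr_natr mulfK // pnatr_eq0 -lt0n fact_gt0 //.
Qed.

(** Its l-th coefficient is the l-th Bernstein coefficient of the Taylor
polynomial at l/n, where the Bernstein operator would use the value at l/n
alone; therefore polynomials of degree at most r are reproduced. *)
Definition quasi_interp {R : realType} (r : nat) (F : nat -> R -> R) (n : nat) : {poly R} :=
  \sum_(l < n.+1) bcoef n l (taylor r F (l%:R / n%:R)) *: bern n l.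

Lemma derivn_XsubC_exp {R : realType} (x : R) j i :
  (('X - x%:P) ^+ j)^`(i) = ('X - x%:P) ^+ (j - i) *+ j ^_ i.
Proof.
elim: i => [|i IHi]; first by rewrite subn0 ffactn0 mulr1n derivn0.
rewrite derivnS IHi derivMn deriv_exp derivXsubC mul1r -mulrnA ffactnSr mulnC.
by rewrite -subnS.
Qed.

Lemma taylor_derivn_center {R : realType} r F i (x : R) : (i <= r)%N ->
  (taylor r F x)^`(i).[x] = F i x.
Proof.
move=> ler; rewrite /taylor raddf_sum horner_sum (bigD1 (Ordinal (ler : (i < r.+1)%N))) //=.
rewrite big1 ?addr0 => [|j]; rewrite derivnZ derivn_XsubC_exp hornerZ hornerMn.
  by rewrite subnn ffactnn expr0 hornerC mulfVK // pnatr_eq0 -lt0n fact_gt0.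
rewrite -val_eqE /= => neji; rewrite horner_exp hornerXsubC subrr expr0n.
case: (ltngtP i j) neji => // [ltij|ltji] _.
  by rewrite subn_eq0 leqNgt ltij mul0rn mulr0.
by rewrite ffact_small // mulr0n mulr0.
Qed.

Lemma taylor_sub {R : realType} r F (x y : R) :
  taylor r F y - taylor r F x =
  \sum_(i < r.+1) ((F i y - (taylor r F x)^`(i).[y]) / i`!%:R) *: ('X - y%:P) ^+ i.
Proof.
rewrite {1}[in X in _ - X](poly_taylor y (size_taylor r F x)) -sumrB.
by apply: eq_bigr => i _; rewrite mulrBl scalerBl.
Qed.

(** F i plays the part of the i-th derivative; the condition is the one of
Whitney's extension theorem on the unit interval. *)
Definition holder_jet {R : realType} r (alpha K : R) (F : nat -> R -> R) : Prop :=
  forall i x y, (i <= r)%N -> 0 <= x <= 1 -> 0 <= y <= 1 ->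
    `|F i y - (taylor r F x)^`(i).[y]| <= K * `|y - x| `^ (alpha - i%:R).

Lemma scalar_bern {R : numFieldType} (L : {scalar {poly R}}) n (p : {poly R}) :
  (size p <= n.+1)%N -> L p = \sum_(l < n.+1) bcoef n l p * L (bern n l).
Proof.
move=> sp; rewrite {1}(bern_expansion sp) raddf_sum; apply: eq_bigr => l _ /=.
exact: linearZ.
Qed.

Lemma natr01 {R : realFieldType} l n : (0 < n)%N -> (l <= n)%N ->
  0 <= (l%:R / n%:R : R) <= 1.
Proof.
by move=> n0 leln; rewrite divr_ge0 //= ler_pdivrMr ?ltr0n // mul1r ler_nat.
Qed.

(** Only the differences between the Taylor polynomials at y = l/n and at x
matter, and their coefficients in front of (X - y)^i are at most
K |y - x|^(alpha - i).  If s = |y - x| / Delta, then |y - x| and the Delta of y are both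
at most (1 + s) Delta, so that each term is at most a constant times
((1 + s) Delta)^alpha, and concentrated_moment finishes. *)
Lemma quasi_interp_error {R : realType} r (alpha K : R) F : r%:R < alpha -> 0 <= K ->
  holder_jet r alpha K F -> exists2 C : R, 0 <= C &
  forall n x (L : {scalar {poly R}}), (0 < n)%N -> (r.*2 <= n)%N -> 0 <= x <= 1 ->
  concentrated n x L ->
  `|L (quasi_interp r F n) - L (taylor r F x)| <= C * Delta n x `^ alpha.
Proof.
move=> ralpha K0 HF.
have alpha0 : 0 <= alpha by rewrite (le_trans (ler0n R r)) // ltW.
have /choice[c Hc] : forall i : nat, exists C : R, 0 <= C /\
    forall n l, (0 < n)%N -> (i.*2 <= n)%N -> (l <= n)%N ->
    `|bcoef n l (('X - (l%:R / n%:R)%:P) ^+ i)| <= C * Delta n (l%:R / n%:R : R) ^+ i.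
  by move=> i; have [C C0 HC] := @bcoef_central_le R i; exists C.
pose B := K * \sum_(i < r.+1) c i.
have B0 : 0 <= B by rewrite mulr_ge0 // sumr_ge0 // => i _; case: (Hc i).
exists (B * (2 * expR 2 * (alpha + 1) `^ (alpha + 1))).
  by rewrite mulr_ge0 // mulr_ge0 ?powR_ge0 // mulr_ge0 ?expR_ge0.
move=> n x L n0 rn x01 Lc; have D0 := Delta_gt0 x n0.
have size_T y : (size (taylor r F y) <= n.+1)%N.
  by rewrite (leq_trans (size_taylor _ _ _)) //; lia.
have -> : L (quasi_interp r F n) - L (taylor r F x) = \sum_(l < n.+1)
    bcoef n l (taylor r F (l%:R / n%:R) - taylor r F x) * L (bern n l).
  rewrite (scalar_bern L (size_T x)) /quasi_interp raddf_sum /= -sumrB.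
  by apply: eq_bigr => l _; rewrite raddfB /= mulrBl; congr (_ - _); exact: linearZ.
rewrite mulrAC; apply: (le_trans (ler_norm_sum _ _ _)).
apply: le_trans (ler_wpM2l _ (concentrated_moment n0 x01 Lc alpha0)); last first.
  by rewrite mulr_ge0 ?powR_ge0.
rewrite mulr_sumr; apply: ler_sum => l _.
have leln : (l <= n)%N by rewrite -ltnS.
have pi0 := Lc.1 l leln; have y01 := @natr01 R l n n0 leln.
rewrite normrM (ger0_norm pi0) mulrC [leRHS]mulrCA; apply: ler_wpM2l => //.
set y := l%:R / n%:R in y01 *.
have [hD _] := Delta_ratio n0 x01 y01.
set s := `|y - x| / Delta n x in hD *; have s0 : 0 <= s by rewrite divr_ge0 // ltW.
pose T := Delta n x * (1 + s).
have T0 : 0 < T by rewrite mulr_gt0 // ltr_pwDl.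
have hd : `|y - x| <= T.
  by rewrite /T mulrDr mulr1 mulrC /s mulfVK ?gt_eqF // lerDr ltW.
rewrite -mulrA -powRM ?addr_ge0 // -/T ?(ltW D0) // taylor_sub bcoef_sum.
apply: (le_trans (ler_norm_sum _ _ _)).
rewrite /B mulr_sumr mulr_suml; apply: ler_sum => i _.
have leir : (i <= r)%N by rewrite -ltnS.
have [ci0 Hci] := Hc i.
rewrite bcoefZ normrM -[leRHS]mulrA.
have h1 : `|(F i y - (taylor r F x)^`(i).[y]) / i`!%:R| <= K * T `^ (alpha - i%:R).
  rewrite normrM normfV normr_nat ler_pdivrMr ?ltr0n ?fact_gt0 //.
  apply: (le_trans (HF i x y leir x01 y01)).
  rewrite -[leLHS]mulr1; apply: ler_pM; rewrite ?mulr_ge0 ?powR_ge0 ?ler1n ?fact_gt0 //.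
  rewrite ler_wpM2l // ge0_ler_powR ?nnegrE ?(ltW T0) //.
  by rewrite subr_ge0 (le_trans _ (ltW ralpha)) // ler_nat.
have h2 : `|bcoef n l (('X - y%:P) ^+ i)| <= c i * T ^+ i.
  have i2n : (i.*2 <= n)%N by rewrite (leq_trans _ rn) // leq_double.
  apply: (le_trans (Hci n l n0 i2n leln)).
  rewrite ler_wpM2l // lerXn2r ?nnegrE ?(ltW T0) //.
  exact: ltW (Delta_gt0 _ n0).
apply: (le_trans (ler_pM _ _ h1 h2)) => //.
rewrite mulrACA -powR_mulrn ?(ltW T0) // -powRD ?subrK ?(gt_eqF T0) ?implybT //.
by rewrite mulrA.
Qed.

(** * The cone of nonnegative Bernstein coefficients *)

(** This form makes the cone visibly closed under addition and elevation of the
degree. *)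
Lemma cone_bcoefP {R : realType} n (p : {poly R}) :
  bernstein_cone n p <-> ((size p <= n.+1)%N /\ forall k, (k <= n)%N -> 0 <= bcoef n k p).
Proof.
split=> [[c c0 ->]|[sp p0]].
  have e (k : 'I_n.+1) : (c k * 'C(n, k)%:R) *: ('X^k * (1 - 'X) ^+ (n - k)) =
      c k *: bern n k by rewrite /bern scalerA.
  under eq_bigr do rewrite e.
  split=> [|k lekn].
    rewrite (leq_trans (size_sum _ _ _)) //; apply/bigmax_leqP => i _.
    by rewrite (leq_trans (size_scale_leq _ _)) // size_bern // -ltnS.
  rewrite bcoef_sum sumr_ge0 // => l _; rewrite bcoefZ mulr_ge0 //.
  by rewrite bcoef_bern_ge0 // leqnn andbT -ltnS.
exists (fun k : 'I_n.+1 => bcoef n k p) => [k|]; first by rewrite p0 // -ltnS.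
by rewrite {1}(bern_expansion sp); apply: eq_bigr => k _; rewrite /bern scalerA.
Qed.

Lemma cone_elevation {R : realType} n m (p : {poly R}) : (n <= m)%N ->
  bernstein_cone n p -> bernstein_cone m p.
Proof.
move=> lenm /cone_bcoefP[sp p0]; apply/cone_bcoefP; split=> [|k lekm].
  exact: leq_trans sp _.
rewrite (bern_expansion sp) bcoef_sum sumr_ge0 // => l _.
have leln : (l <= n)%N by rewrite -ltnS.
by rewrite bcoefZ mulr_ge0 ?p0 // bcoef_bern_ge0 // leln.
Qed.

Lemma cone0 {R : realType} n : bernstein_cone n (0 : {poly R}).
Proof.
by apply/cone_bcoefP; rewrite size_poly0; split=> // k _; rewrite /bcoef big1 // => i _;
  rewrite coef0 mul0r.
Qed.

Lemma coneD {R : realType} n (p q : {poly R}) :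
  bernstein_cone n p -> bernstein_cone n q -> bernstein_cone n (p + q).
Proof.
move=> /cone_bcoefP[sp p0] /cone_bcoefP[sq q0]; apply/cone_bcoefP; split=> [|k lekn].
  by rewrite (leq_trans (size_polyD _ _)) // geq_max sp.
by rewrite raddfD addr_ge0 ?p0 ?q0.
Qed.

Definition Delta_poly {R : realType} (alpha : R) (n : nat) : {poly R} :=
  \sum_(l < n.+1) (Delta n (l%:R / n%:R) `^ alpha) *: bern n l.

Lemma size_bern_sum {R : numFieldType} n (c : nat -> R) :
  (size (\sum_(l < n.+1) c l *: bern n l)%R <= n.+1)%N.
Proof.
rewrite (leq_trans (size_sum _ _ _)) //; apply/bigmax_leqP => i _.
by rewrite (leq_trans (size_scale_leq _ _)) // size_bern // -ltnS.
Qed.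

Lemma scalar_bern_sum {R : numFieldType} (L : {scalar {poly R}}) n (c : nat -> R) :
  L (\sum_(l < n.+1) c l *: bern n l) = \sum_(l < n.+1) c l * L (bern n l).
Proof. by rewrite raddf_sum; apply: eq_bigr => l _ /=; exact: linearZ. Qed.

(** The upper bound is a moment estimate.  The lower bound is Jensen's inequality
for t |-> 1/t, applied to t = (1 + s)^alpha with s = |l/n - x| / Delta. *)
Lemma Delta_poly_bounds {R : realType} (alpha : R) : 0 <= alpha ->
  exists2 C : R, 0 < C & forall n x (L : {scalar {poly R}}), (0 < n)%N ->
  0 <= x <= 1 -> concentrated n x L ->
  L (Delta_poly alpha n) <= C * Delta n x `^ alpha /\
  C^-1 * Delta n x `^ alpha <= L (Delta_poly alpha n).
Proof.
move=> alpha0; set C := 2 * expR 2 * (alpha + 1) `^ (alpha + 1).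
have C0 : 0 < C by rewrite mulr_gt0 ?powR_gt0 ?ltr_wpDl // mulr_gt0 ?expR_gt0.
exists C => // n x L n0 x01 Lc; have D0 := Delta_gt0 x n0.
have Hm := concentrated_moment n0 x01 Lc alpha0; rewrite -/C in Hm.
rewrite /Delta_poly (scalar_bern_sum L n (fun l => Delta n (l%:R / n%:R) `^ alpha)).
split.
  apply: le_trans (ler_wpM2r (powR_ge0 _ _) Hm); rewrite mulr_suml.
  apply: ler_sum => l _; have leln : (l <= n)%N by rewrite -ltnS.
  rewrite [leLHS]mulrC -[leRHS]mulrA; apply: ler_wpM2l; first exact: Lc.1.
  have [+ _] := Delta_ratio n0 x01 (@natr01 R l n n0 leln).
  set s := `|_| / _; have s0 : 0 <= s by rewrite divr_ge0 // ltW.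
  move=> h; rewrite [leRHS]mulrC -powRM ?(ltW D0) ?addr_ge0 //.
  apply: ge0_ler_powR => //; rewrite nnegrE; first exact/ltW/Delta_gt0.
  by rewrite mulr_ge0 ?addr_ge0 // ltW.
have L1 : \sum_(l < n.+1) L (bern n l) = 1.
  by rewrite -(raddf_sum L) /= sum_bern Lc.2.1.
have : C^-1 = \sum_(l < n.+1) (C^-1 * 2) * L (bern n l) - C^-1 ^+ 2 * C.
  by rewrite -mulr_sumr L1 mulr1; field; rewrite gt_eqF.
move=> CE.
apply: (@le_trans _ _ ((\sum_(l < n.+1) (C^-1 * 2) * L (bern n l) - C^-1 ^+ 2 *
   \sum_(l < n.+1) L (bern n l) * (1 + `|l%:R / n%:R - x| / Delta n x) `^ alpha) *
   Delta n x `^ alpha)).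
  rewrite ler_wpM2r ?powR_ge0 // {1}CE lerD // lerN2 ler_wpM2l ?sqr_ge0 //.
rewrite mulr_sumr -sumrB mulr_suml; apply: ler_sum => l _.
have leln : (l <= n)%N by rewrite -ltnS.
have [_] := Delta_ratio n0 x01 (@natr01 R l n n0 leln).
set s := `|_| / _; have s0 : 0 <= s by rewrite divr_ge0 // ltW.
set y := _ / _ => h.
have {}h : Delta n x `^ alpha <= Delta n y `^ alpha * (1 + s) `^ alpha.
  have Dy0 := Delta_gt0 y n0.
  rewrite -powRM ?addr_ge0 ?(ltW Dy0) //.
  apply: ge0_ler_powR => //; rewrite nnegrE; first exact: ltW.
  by rewrite mulr_ge0 ?addr_ge0 // ltW.
have pi0 := Lc.1 l leln.
have -> : (C^-1 * 2 * L (bern n l) - C^-1 ^+ 2 * (L (bern n l) * (1 + s) `^ alpha)) *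
   Delta n x `^ alpha = L (bern n l) *
   ((C^-1 * 2 - C^-1 ^+ 2 * (1 + s) `^ alpha) * Delta n x `^ alpha) by ring.
rewrite [leRHS]mulrC; apply: ler_wpM2l => //.
have : 0 < (1 + s) `^ alpha by rewrite powR_gt0 // ltr_pwDl.
have : 0 <= Delta n x `^ alpha by exact: powR_ge0.
have : 0 <= Delta n y `^ alpha by exact: powR_ge0.
move: (Delta n x `^ alpha) (Delta n y `^ alpha) ((1 + s) `^ alpha) h => a b t h b0 a0 t0.
(* tangent line of the convex function t |-> 1 / t at t = C *)
have ht : C^-1 * 2 - C^-1 ^+ 2 * t <= t^-1.
  rewrite -(ler_pM2r t0) mulVf ?gt_eqF // -subr_ge0.
  have -> : 1 - (C^-1 * 2 - C^-1 ^+ 2 * t) * t = (C^-1 * t - 1) ^+ 2 by ring.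
  exact: sqr_ge0.
apply: (le_trans (ler_wpM2r a0 ht)).
by rewrite mulrC ler_pdivrMr.
Qed.

(** * Approximants increasing in the order of the cone *)

Lemma Delta_small {R : realType} (e : R) : 0 < e ->
  exists2 N, (0 < N)%N & forall n x, (N <= n)%N -> 0 <= x <= 1 -> Delta n x <= e.
Proof.
move=> e0; set N := Num.bound (e ^- 2).
have hN : e ^- 2 < N%:R by apply: archi_boundP; rewrite invr_ge0 exprn_ge0 // ltW.
have N0 : (0 < N)%N.
  by rewrite -(@ltr0n R) (le_lt_trans _ hN) // invr_ge0 exprn_ge0 // ltW.
exists N => // n x leNn x01; have n0 := leq_trans N0 leNn.
rewrite -(@ler_pXn2r _ 2) ?nnegrE ?(ltW e0) //; last exact/ltW/Delta_gt0.
apply: (le_trans (Delta_sq_le n0 x01)).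
have nR : 0 < n%:R :> R by rewrite ltr0n.
have e20 : 0 < e ^+ 2 by rewrite exprn_gt0.
rewrite -[leRHS]invrK lef_pV2 ?posrE ?invr_gt0 //.
by rewrite (le_trans (ltW hN)) // ler_nat.
Qed.

(** The terms of order i >= 1 of a Taylor polynomial contribute O(Delta) to its
coefficients, and F 0 (l/n) is the term of order 0. *)
Lemma bcoef_taylor_ge {R : realType} r (Kb : R) F :
  (forall i x, (i <= r)%N -> 0 <= x <= 1 -> `|F i x| <= Kb) ->
  exists2 C : R, 0 <= C & forall n l, (0 < n)%N -> (r.*2 <= n)%N -> (l <= n)%N ->
  F 0%N (l%:R / n%:R) - C * Delta n (l%:R / n%:R) <=
    bcoef n l (taylor r F (l%:R / n%:R)).
Proof.
move=> HF.
have Kb0 : 0 <= Kb.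
  by apply: le_trans (HF 0%N 0 (leq0n _) _); rewrite ?normr_ge0 ?lexx ?ler01.
have /choice[c Hc] : forall i : nat, exists C : R, 0 <= C /\
    forall n l, (0 < n)%N -> (i.*2 <= n)%N -> (l <= n)%N ->
    `|bcoef n l (('X - (l%:R / n%:R)%:P) ^+ i)| <= C * Delta n (l%:R / n%:R : R) ^+ i.
  by move=> i; have [C C0 HC] := @bcoef_central_le R i; exists C.
exists (\sum_(i < r) Kb * c i.+1).
  by apply: sumr_ge0 => i _; rewrite mulr_ge0 //; case: (Hc i.+1).
move=> n l n0 rn leln; have x01 := @natr01 R l n n0 leln.
set x := l%:R / n%:R in x01 *.
rewrite /taylor bcoef_sum big_ord_recl /= bcoefZ expr0 bcoef1 fact0 divr1 mulr1.
rewrite lerD2l mulr_suml -sumrN; apply: ler_sum => i _; rewrite /bump /= add1n.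
have leir : (i.+1 <= r)%N by [].
have [ci0 Hci] := Hc i.+1.
have h2 : `|bcoef n l (('X - x%:P) ^+ i.+1)| <= c i.+1 * Delta n x.
  have i2n : (i.+1.*2 <= n)%N by rewrite (leq_trans _ rn) // leq_double.
  apply: (le_trans (Hci n l n0 i2n leln)).
  rewrite ler_wpM2l // exprS -[leRHS]mulr1 ler_wpM2l ?exprn_ile1 ?Delta_le1 //;
    exact/ltW/Delta_gt0.
have h1 : `|F i.+1 x / i.+1`!%:R| <= Kb.
  rewrite normrM normfV normr_nat ler_pdivrMr ?ltr0n ?fact_gt0 //.
  rewrite (le_trans (HF i.+1 x leir x01)) // -[leLHS]mulr1 ler_wpM2l //.
  by rewrite ler1n fact_gt0.
rewrite bcoefZ lerNl (le_trans (ler_norm _)) // normrN normrM -mulrA.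
exact: ler_pM.
Qed.

Lemma size_quasi_interp {R : realType} r (F : nat -> R -> R) n :
  (size (quasi_interp r F n) <= n.+1)%N.
Proof. exact: (size_bern_sum n (fun l => bcoef n l (taylor r F (l%:R / n%:R)))). Qed.

Lemma size_Delta_poly {R : realType} (alpha : R) n : (size (Delta_poly alpha n) <= n.+1)%N.
Proof. exact: (size_bern_sum n (fun l => Delta n (l%:R / n%:R) `^ alpha)). Qed.

(** The coefficients of the quasi-interpolants of degrees n and q n differ by at
most C1 Delta^alpha when compared in degree q n.  The multiple A of the cone
polynomial compensates this: in degree q n its coefficients are at
least A Delta^alpha / C2 = 2 C1 Delta^alpha in the old step and are at most
C1 Delta^alpha in the new one. *)
Lemma approximants {R : realType} r (alpha K Kb m : R) F :
  0 < alpha -> r%:R < alpha -> 0 <= K -> holder_jet r alpha K F ->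
  0 < m -> (forall x, 0 <= x <= 1 -> m <= F 0%N x) ->
  (forall i x, (i <= r)%N -> 0 <= x <= 1 -> `|F i x| <= Kb) ->
  exists (g : nat -> {poly R}) (n0 q : nat) (C : R),
  [/\ (0 < n0)%N /\ (1 < q)%N, 0 <= C, bernstein_cone n0 (g n0),
   forall n, (n0 <= n)%N -> bernstein_cone (q * n) (g (q * n)%N - g n) &
   forall n x, (n0 <= n)%N -> 0 <= x <= 1 ->
     `|F 0%N x - (g n).[x]| <= C * Delta n x `^ alpha].
Proof.
move=> alpha0 ralpha K0 HF m0 Fm FK.
have [C1 C10 Herr] := quasi_interp_error ralpha K0 HF.
have [C2 C20 HD] := Delta_poly_bounds (ltW alpha0).
have [C3 C30 Hlow] := bcoef_taylor_ge FK.
pose A := 2 * C1 * C2.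
have A0 : 0 <= A by rewrite !mulr_ge0 // ltW.
(* q is so large that q^(- alpha / 2) <= 1 / (2 * C2) *)
pose q := (Num.bound ((2 * C2) `^ (2 / alpha))).+2.
have hq : (2 * C2) `^ (2 / alpha) <= q%:R.
  have := @archi_boundP R ((2 * C2) `^ (2 / alpha)) (powR_ge0 _ _).
  by move/ltW/le_trans; apply; rewrite ler_nat /q; apply: leqW; exact: leqW.
(* Delta <= e makes C3 Delta and A Delta^alpha at most m / 2 *)
pose e := Num.min (m / (2 * (C3 + 1))) ((m / (2 * (A + 1))) `^ (alpha^-1)).
have C31 : 0 < C3 + 1 by rewrite ltr_wpDl.
have A1 : 0 < A + 1 by rewrite ltr_wpDl.
have mA0 : 0 < m / (2 * (A + 1)) by rewrite divr_gt0 ?mulr_gt0.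
have e0 : 0 < e by rewrite lt_min divr_gt0 ?mulr_gt0 // powR_gt0.
have [N N0 HN] := Delta_small e0.
pose n0 := maxn N r.*2.
have leNn0 : (N <= n0)%N by rewrite leq_maxl.
have lern0 : (r.*2 <= n0)%N by rewrite leq_maxr.
have n00 : (0 < n0)%N by apply: leq_trans leNn0.
pose g n := quasi_interp r F n - A *: Delta_poly alpha n.
exists g, n0, q, (C1 + A * C2); split => //.
- by rewrite addr_ge0 // mulr_ge0 // ltW.
- rewrite /g /quasi_interp /Delta_poly scaler_sumr -sumrB.
  have -> : \sum_(l < n0.+1) (bcoef n0 l (taylor r F (l%:R / n0%:R)) *: bern n0 l -
     A *: (Delta n0 (l%:R / n0%:R) `^ alpha *: bern n0 l)) =
    \sum_(l < n0.+1) ((bcoef n0 l (taylor r F (l%:R / n0%:R)) -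
       A * Delta n0 (l%:R / n0%:R) `^ alpha) * 'C(n0, l)%:R) *:
          ('X^l * (1 - 'X) ^+ (n0 - l)).
    by apply: eq_bigr => l _; rewrite -[in RHS]scalerA scalerBl scalerA.
  exists (fun l : 'I_n0.+1 => bcoef n0 l (taylor r F (l%:R / n0%:R)) -
       A * Delta n0 (l%:R / n0%:R) `^ alpha) => // l.
  have leln : (l <= n0)%N by rewrite -ltnS.
  have x01 := @natr01 R l n0 n00 leln.
  rewrite subr_ge0; apply: le_trans (Hlow n0 l n00 lern0 leln).
  move: (Fm _ x01) (HN n0 _ leNn0 x01) (Delta_gt0 (l%:R / n0%:R : R) n00).
  move: (l%:R / n0%:R) => x Fx; rewrite le_min => /andP[h1 h2] D0.
  have h3 : C3 * Delta n0 x <= m / 2.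
    apply: (@le_trans _ _ ((C3 + 1) * Delta n0 x)); first by rewrite ler_wpM2r ?(ltW D0) ?lerDl.
    by rewrite -ler_pdivlMl // mulrC -mulrA -invfM.
  have h4 : A * Delta n0 x `^ alpha <= m / 2.
    apply: (@le_trans _ _ ((A + 1) * Delta n0 x `^ alpha)).
      by rewrite ler_wpM2r ?powR_ge0 // lerDl.
    rewrite -ler_pdivlMl // mulrC -mulrA -invfM.
    have -> : m / (2 * (A + 1)) = ((m / (2 * (A + 1))) `^ (alpha^-1)) `^ alpha.
      by rewrite -powRrM mulVf ?gt_eqF // powRr1 // ltW.
    by apply: ge0_ler_powR; rewrite ?nnegrE ?(ltW alpha0) ?(ltW D0) ?powR_ge0.
  by lra.
- move=> n n0n.
  have n_gt0 : (0 < n)%N by apply: leq_trans n0n.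
  have lenM : (n <= q * n)%N by rewrite leq_pmull.
  have M0 : (0 < q * n)%N by apply: leq_trans lenM.
  have rn : (r.*2 <= n)%N by apply: leq_trans n0n.
  set M := (q * n)%N in lenM M0 *.
  have size_g n' : (size (g n') <= n'.+1)%N.
    rewrite /g (leq_trans (size_polyD _ _)) // geq_max size_quasi_interp size_polyN.
    by rewrite (leq_trans (size_scale_leq _ _)) // size_Delta_poly.
  have -> : g M - g n = \sum_(k < M.+1) (bcoef M k (taylor r F (k%:R / M%:R)) -
       A * Delta M (k%:R / M%:R) `^ alpha - bcoef M k (g n)) *: bern M k.
    have sgn : (size (g n) <= M.+1)%N by rewrite (leq_trans (size_g _)).
    rewrite [X in _ - X = _](bern_expansion sgn) {1}/g /quasi_interp /Delta_poly.
    rewrite scaler_sumr -!sumrB.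
    by apply: eq_bigr => k _; rewrite !scalerBl scalerA.
  exists (fun k : 'I_M.+1 => bcoef M k (taylor r F (k%:R / M%:R)) -
       A * Delta M (k%:R / M%:R) `^ alpha - bcoef M k (g n)); last first.
    by apply: eq_bigr => k _; rewrite /bern scalerA.
  move=> k; have lekM : (k <= M)%N by rewrite -ltnS.
  have x01 := @natr01 R k M M0 lekM.
  have Hc := @concentrated_bcoef R n M k M0 lenM lekM.
  have := Herr n _ _ n_gt0 rn x01 Hc; have := (HD n _ _ n_gt0 x01 Hc).2 => /=.
  have := @Delta_degree_anti R n M _ _ x01; rewrite n_gt0 lenM => /(_ isT).
  rewrite /g raddfB /= bcoefZ.
  move: x01 (Delta_gt0 (k%:R / M%:R : R) n_gt0) (Delta_gt0 (k%:R / M%:R : R) M0).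
  move: (k%:R / M%:R) => x x01 D0 DM0 hM hD /ler_normlP[_ herr].
  have hMa : Delta M x `^ alpha <= (2 * C2)^-1 * Delta n x `^ alpha.
    have qR : 0 < q%:R :> R by rewrite ltr0n.
    have nM : n%:R / M%:R = q%:R^-1 :> R.
      by rewrite /M natrM invfM mulrCA mulfV ?mulr1 // pnatr_eq0 -lt0n.
    rewrite nM in hM; rewrite (powR_sqr _ (ltW D0)) (powR_sqr _ (ltW DM0)).
    apply: (@le_trans _ _ ((q%:R^-1 * Delta n x ^+ 2) `^ (alpha / 2))).
      by apply: ge0_ler_powR; rewrite ?nnegrE ?mulr_ge0 ?invr_ge0 ?sqr_ge0 // ltW // divr_gt0.
    rewrite powRM ?invr_ge0 ?sqr_ge0 ?ler0n // ler_wpM2r ?powR_ge0 //.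
    have -> : (2 * C2)^-1 = ((2 * C2) `^ (2 / alpha))^-1 `^ (alpha / 2).
      have C22 : 0 <= 2 * C2 by rewrite mulr_ge0 // ltW.
      rewrite -[in RHS]powR_inv1 ?powR_ge0 // powRAC -(powRrM (2 * C2)).
      have -> : 2 / alpha * (alpha / 2) = 1 by field; rewrite gt_eqF.
      by rewrite powRr1 // powR_inv1.
    apply: ge0_ler_powR; rewrite ?nnegrE ?invr_ge0 ?powR_ge0 ?ler0n ?divr_ge0 ?(ltW alpha0) //.
    by rewrite lef_pV2 ?posrE ?powR_gt0 ?mulr_gt0.
  have hA1 : A * Delta M x `^ alpha <= C1 * Delta n x `^ alpha.
    apply: (le_trans (ler_wpM2l A0 hMa)); rewrite mulrA /A.
    by rewrite le_eqVlt; apply/orP; left; apply/eqP; field; rewrite gt_eqF.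
  have hA2 : 2 * C1 * Delta n x `^ alpha <= A * bcoef M k (Delta_poly alpha n).
    apply: le_trans (ler_wpM2l A0 hD); rewrite mulrA /A mulfK ?gt_eqF //.
  by lra.
move=> n x n0n x01.
have n_gt0 : (0 < n)%N by apply: leq_trans n0n.
have rn : (r.*2 <= n)%N by apply: leq_trans n0n.
have Hc := concentrated_horner n x01.
have := Herr n _ _ n_gt0 rn x01 Hc; have := (HD n _ _ n_gt0 x01 Hc).1.
have : 0 <= (Delta_poly alpha n).[x].
  rewrite horner_sum sumr_ge0 // => l _; rewrite hornerZ mulr_ge0 ?powR_ge0 //.
  exact: horner_bern_ge0.
rewrite /= /horner_eval.
have -> : (taylor r F x).[x] = F 0%N x by have := taylor_derivn_center F x (leq0n r).
rewrite /g hornerD hornerN hornerZ => D1 D2 h.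
have -> : F 0%N x - ((quasi_interp r F n).[x] - A * (Delta_poly alpha n).[x]) =
   - ((quasi_interp r F n).[x] - F 0%N x) + A * (Delta_poly alpha n).[x] by ring.
apply: (le_trans (ler_normD _ _)); rewrite normrN mulrDl lerD //.
by rewrite normrM !ger0_norm // -mulrA ler_wpM2l.
Qed.

(** * The series of a function with Taylor remainders of Hoelder type *)

(** Q n is the last member g m, m = n0 q^j, of degree at most n, so that the
increments Q (n + 1) - Q n are defined for all degrees; it is 0 below n0. *)
Lemma cone_chain {R : realType} (g : nat -> {poly R}) n0 q : (0 < n0)%N -> (1 < q)%N ->
  bernstein_cone n0 (g n0) ->
  (forall n, (n0 <= n)%N -> bernstein_cone (q * n) (g (q * n)%N - g n)) ->
  exists2 Q : nat -> {poly R}, Q 0%N = 0 /\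
    (forall n, bernstein_cone n.+1 (Q n.+1 - Q n)) &
    (forall n, (n < n0)%N -> Q n = 0) /\
    forall n, (n0 <= n)%N -> exists2 m, (n0 <= m <= n)%N && (n <= q * m)%N & Q n = g m.
Proof.
move=> n00 q1 g0 gS.
pose N j := (n0 * q ^ j)%N.
have leN j : (n0 <= N j)%N by rewrite /N leq_pmulr // expn_gt0 (ltnW q1).
have chain i j : (i <= j)%N -> bernstein_cone (N j) (g (N j) - g (N i)).
  move=> leij; rewrite -(subnKC leij); move: (j - i)%N => d {j leij}; rename i into j.
  elim: d => [|d IHd]; first by rewrite addn0 subrr; exact: cone0.
  have NS : N (j + d.+1)%N = (q * N (j + d)%N)%N.
    by rewrite /N addnS expnS mulnCA.
  have -> : g (N (j + d.+1)%N) - g (N j) =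
     (g (N (j + d.+1)%N) - g (N (j + d)%N)) + (g (N (j + d)%N) - g (N j)).
    by rewrite addrA subrK.
  apply: coneD; first by rewrite NS; exact: gS.
  by apply: cone_elevation IHd; rewrite NS leq_pmull // ltnW.
pose t n := trunc_log q (n %/ n0).
have div_gt0 n : (n0 <= n)%N -> (0 < n %/ n0)%N by rewrite divn_gt0.
have leNt n : (n0 <= n)%N -> (N (t n) <= n)%N.
  move=> n0n; rewrite /N (leq_trans _ (leq_divM n n0)) // mulnC leq_mul2r.
  by rewrite trunc_logP ?orbT // div_gt0.
have ltNt n : (n0 <= n)%N -> (n <= q * N (t n))%N.
  move=> n0n; rewrite /N mulnCA -expnS mulnC ltnW // -ltn_divLR //.
  exact: trunc_log_ltn.
exists (fun n => if (n < n0)%N then 0 else g (N (t n))); last first.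
  split=> n => [->//|n0n]; rewrite ltnNge n0n /=; exists (N (t n)) => //.
  by rewrite leN leNt // ltNt.
split=> [|n]; first by rewrite n00.
case: (ltnP n.+1 n0) => [lt1|ge1].
  by rewrite (ltnW lt1) subrr; exact: cone0.
case: ltnP => [lt2|ge2].
  rewrite subr0; apply: (cone_elevation (leNt _ ge1)).
  have e0 : N 0%N = n0 by rewrite /N expn0 muln1.
  have -> : g (N (t n.+1)) = (g (N (t n.+1)) - g (N 0%N)) + g (N 0%N) by rewrite subrK.
  apply: coneD; first exact: chain.
  by apply: (@cone_elevation _ n0); rewrite ?leN // e0.
apply: (cone_elevation (leNt _ ge1)).
exact/chain/leq_trunc_log/leq_div2r.
Qed.

Definition Bernstein_series {R : realType} (alpha : R) (f : R -> R)
    (F : nat -> {poly R}) : Prop :=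
  [/\ forall n, (1 <= n)%N -> bernstein_cone n (F n),
      forall x, x \in `[0, 1] ->
        \sum_(1 <= n < N) (F n).[x] @[N --> \oo] --> f x
    & exists C : R, forall x, x \in `[0, 1] -> forall n, (1 <= n)%N ->
        (\sum_(n.+1 <= k <oo) ((F k).[x])%:E
           <= (C * (Delta n x) `^ alpha)%:E)%E].

Lemma cone_horner_ge0 {R : realType} n (p : {poly R}) x : bernstein_cone n p ->
  0 <= x <= 1 -> 0 <= p.[x].
Proof.
move=> /cone_bcoefP[sp p0] x01; rewrite (bern_expansion sp) horner_sum sumr_ge0 // => k _.
by rewrite hornerZ mulr_ge0 ?horner_bern_ge0 // p0 // -ltnS.
Qed.

Lemma Bernstein_series_of_sums {R : realType} (alpha C : R) f (Q : nat -> {poly R}) :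
  0 < alpha -> 0 <= C -> Q 0%N = 0 -> (forall n, bernstein_cone n.+1 (Q n.+1 - Q n)) ->
  (forall n x, (0 < n)%N -> 0 <= x <= 1 -> `|f x - (Q n).[x]| <= C * Delta n x `^ alpha) ->
  Bernstein_series alpha f (fun n => Q n - Q n.-1).
Proof.
move=> alpha0 C0 Q0 Qcone Qerr.
have sumQ m n x : (m <= n)%N ->
    \sum_(m.+1 <= k < n.+1) (Q k - Q k.-1).[x] = (Q n).[x] - (Q m).[x].
  elim: n => [|n IHn]; first by case: m => // _; rewrite big_geq // subrr.
  rewrite leq_eqVlt => /orP[/eqP->|lemn]; first by rewrite big_geq // subrr.
  by rewrite big_nat_recr //= IHn // hornerD hornerN; ring.
split=> [[//|n] _|x|]; first exact: Qcone.
  rewrite in_itv /= => x01; apply/cvgrPdist_le => e e0.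
  have [d d0 Hd] := powR_small alpha0 C0 e0.
  have d20 : 0 < d / 2 by rewrite divr_gt0.
  have [N N0 HN] := Delta_small d20.
  exists N.+1 => // -[//|n] /= ltNn; rewrite ltnS in ltNn.
  have n0 := leq_trans N0 ltNn.
  rewrite (sumQ 0%N) // Q0 horner0 subr0 (le_trans (Qerr n x n0 x01)) // Hd //.
    exact/ltW/Delta_gt0.
  by have := HN n x ltNn x01; lra.
exists (2 * C) => x; rewrite in_itv /= => x01 n n0.
apply: lime_le.
  apply: is_cvg_nneseries => -[//|k] _ _; rewrite lee_fin.
  exact: cone_horner_ge0 (Qcone k) x01.
exists n.+2 => // -[//|k] /= ltnk; rewrite sumEFin lee_fin.
have lenk : (n <= k)%N by lia.
have k0 : (0 < k)%N by lia.
rewrite sumQ //.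
have hD : Delta k x `^ alpha <= Delta n x `^ alpha.
  have Dn0 := Delta_gt0 x n0; have Dk0 := Delta_gt0 x k0.
  apply: ge0_ler_powR; rewrite ?nnegrE ?(ltW alpha0) ?(ltW Dn0) ?(ltW Dk0) //.
  rewrite -(@ler_pXn2r _ 2) ?nnegrE ?(ltW Dn0) ?(ltW Dk0) //.
  have := @Delta_degree_anti R n k x; rewrite n0 lenk => /(_ isT x01)/le_trans; apply.
  rewrite -[leRHS]mul1r ler_wpM2r ?sqr_ge0 // ler_pdivrMr ?ltr0n // mul1r ler_nat.
  exact: lenk.
have /ler_normlP[hk1 hk2] := Qerr k x k0 x01.
have /ler_normlP[hn1 hn2] := Qerr n x n0 x01.
have := ler_wpM2l C0 hD.
by lra.
Qed.

Lemma Bernstein_series_of_jet {R : realType} r (alpha K Kb m : R) F :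
  0 < alpha -> r%:R < alpha -> 0 <= K -> holder_jet r alpha K F ->
  0 < m -> (forall x, 0 <= x <= 1 -> m <= F 0%N x) ->
  (forall i x, (i <= r)%N -> 0 <= x <= 1 -> `|F i x| <= Kb) ->
  exists G, Bernstein_series alpha (F 0%N) G.
Proof.
move=> alpha0 ralpha K0 HF m0 Fm FK.
have [g [n0 [q [C [[n00 q1] C0 g0 gS gerr]]]]] := approximants alpha0 ralpha K0 HF m0 Fm FK.
have [Q [Q0 Qcone] [Qz Qg]] := cone_chain n00 q1 g0 gS.
have Kb0 : 0 <= Kb.
  by apply: le_trans (FK 0%N 0 (leq0n _) _); rewrite ?normr_ge0 ?lexx ?ler01.
have CC0 : 0 <= C * q%:R `^ alpha by rewrite mulr_ge0 ?powR_ge0.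
have KK0 : 0 <= Kb * n0%:R `^ alpha by rewrite mulr_ge0 ?powR_ge0.
exists (fun n => Q n - Q n.-1).
apply: (@Bernstein_series_of_sums _ _ (C * q%:R `^ alpha + Kb * n0%:R `^ alpha)) => //.
  exact: addr_ge0.
move=> n x n_gt0 x01; have D0 := Delta_gt0 x n_gt0.
have DR : 0 <= Delta n x `^ alpha by exact: powR_ge0.
have [ltn0|le0n] := ltnP n n0.
  rewrite Qz // horner0 subr0 (le_trans (FK 0%N x (leq0n _) x01)) //.
  rewrite mulrDl -[leLHS]add0r lerD ?mulr_ge0 //.
  rewrite -mulrA -[leLHS]mulr1 ler_wpM2l // -powRM ?(ltW D0) //.
  apply: (@le_trans _ _ (1 `^ alpha)); first by rewrite powR1.
  apply: ge0_ler_powR; rewrite ?nnegrE ?(ltW alpha0) ?mulr_ge0 ?(ltW D0) //.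
  have nR : 0 < n%:R :> R by rewrite ltr0n.
  by rewrite -[leLHS](mulfV (lt0r_neq0 nR)) ler_pM ?invr_ge0 ?Delta_ge_inv ?ler_nat ?(ltnW ltn0).
have [k /andP[/andP[n0k lekn] lenq] ->] := Qg n le0n.
have k0 : (0 < k)%N by apply: leq_trans n0k.
have Dk0 := Delta_gt0 x k0.
rewrite (le_trans (gerr k x n0k x01)) // mulrDl -[leLHS]addr0 lerD ?mulr_ge0 //.
rewrite -mulrA ler_wpM2l // -powRM ?(ltW D0) //.
apply: ge0_ler_powR; rewrite ?nnegrE ?(ltW alpha0) ?mulr_ge0 ?(ltW D0) ?(ltW Dk0) //.
have := @Delta_degree_mono R k n x; rewrite k0 lekn => /(_ isT x01)/le_trans; apply.
rewrite ler_wpM2r ?(ltW D0) // ler_pdivrMr ?ltr0n // -natrM ler_nat.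
exact: lenq.
Qed.

(** * Derivatives of polynomials in the cone *)

Lemma prim_root_exists (C : numClosedFieldType) n : (0 < n)%N ->
  exists z : C, n.-primitive_root z.
Proof.
move=> n_gt0; have [r Dp] := closed_field_poly_normal ('X^n - 1 : {poly C}).
rewrite (monicP _) ?monicXnsubC // scale1r in Dp.
have rn1 : all n.-unity_root r by apply/allP=> z; rewrite -root_prod_XsubC -Dp.
have sz_r : (n <= size r)%N.
  by rewrite -ltnS -(size_prod_XsubC r id) -Dp size_XnsubC.
have [|z _ pz] := hasP (has_prim_root n_gt0 rn1 _ sz_r); last by exists z.
by rewrite -separable_prod_XsubC -Dp separable_Xn_sub_1 // pnatr_eq0 -lt0n.
Qed.

(** Cauchy's estimate for a polynomial of degree less than m, with the integral
over the unit circle replaced by the average over the m-th roots of unity. *)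
Lemma cauchy_coef_le (C : numClosedFieldType) m (a : nat -> C) (B : C) :
  (forall z, `|z| = 1 -> `|\sum_(k < m) a k * z ^+ k| <= B) ->
  forall i, (i < m)%N -> `|a i| <= B.
Proof.
move=> HB i ltim; have m0 : (0 < m)%N by apply: leq_ltn_trans ltim.
have [z pz] := @prim_root_exists C m m0.
have zm := prim_expr_order pz.
have z1 : `|z| = 1.
  by apply/eqP; rewrite -(@pexpr_eq1 _ _ m) // -normrX zm normr1.
have geo k : (k < m)%N ->
    \sum_(j < m) (z ^+ (k + (m - i))) ^+ j = (if k == i then m%:R else 0).
  move=> ltkm; case: eqP => [->|neki].
    by rewrite subnKC ?(ltnW ltim) // zm; under eq_bigr do rewrite expr1n;
      rewrite sumr_const card_ord.
  set w := z ^+ _; have w1 : w - 1 != 0.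
    rewrite subr_eq0 /w -(prim_order_dvd pz); apply/negP => /dvdnP[[|[|d]] e]; nia.
  by apply: (mulfI w1); rewrite mulr0 -subrX1 /w -exprM mulnC exprM zm expr1n subrr.
have sumE : \sum_(j < m) (\sum_(k < m) a k * (z ^+ j) ^+ k) * (z ^+ j) ^+ (m - i) = m%:R * a i.
  under eq_bigr do rewrite mulr_suml.
  rewrite exchange_big /= (bigD1 (Ordinal ltim)) //= [X in _ + X]big1 ?addr0.
    under eq_bigr do rewrite -mulrA -exprD exprAC.
    by rewrite -mulr_sumr geo // eqxx mulrC.
  move=> k; rewrite -val_eqE /= => neki.
  under eq_bigr do rewrite -mulrA -exprD exprAC.
  by rewrite -mulr_sumr geo // (negPf neki) mulr0.
have mC : 0 < m%:R :> C by rewrite ltr0n.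
rewrite -(ler_pM2l mC) -[X in X * `|_|]normr_nat -normrM -sumE.
apply: (le_trans (ler_norm_sum _ _ _)).
rewrite mulr_natl -[m in leRHS]card_ord -sumr_const; apply: ler_sum => j _.
by rewrite normrM !normrX z1 !expr1n mulr1 HB // normrX z1 expr1n.
Qed.

Lemma sqrt_le_of_sq {R : realType} (u v : R) : 0 <= v -> u <= v ^+ 2 -> Num.sqrt u <= v.
Proof.
move=> v0 uv; rewrite -(ger0_norm v0) -sqrtr_sqr ler_wsqrtr //.
Qed.

Lemma sqrt_circle_le {R : realType} (x d c : R) : 0 < x -> -1 <= c -> 0 <= d ->
  Num.sqrt (x ^+ 2 + 2 * x * d * c + d ^+ 2) <= x + d * c + d ^+ 2 / (2 * x).
Proof.
move=> x0 cm d0; have e : 2 * x * (d ^+ 2 / (2 * x)) = d ^+ 2.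
  by rewrite mulrCA mulfV ?mulr1 // mulf_neq0 // gt_eqF.
move: (d ^+ 2 / (2 * x)) e => t e; apply: sqrt_le_of_sq; last first.
  have := sqr_ge0 (d * c + t); rewrite -e => h; nra.
have h : 0 <= d * (c + 1) by rewrite mulr_ge0 //; lra.
have h2 : 0 <= x - d + t by have := sqr_ge0 (x - d); have := sqr_ge0 x; nra.
by lra.
Qed.

(** On the circle of radius d around x.  Near the end points d = 1/n and the
triangle inequality suffices.  Elsewhere d^2 = x (1 - x) / n, and expanding
the two square roots to first order the terms in d c cancel; what is left is
d^2 / (2 x) + d^2 / (2 (1 - x)) = 1 / (2 n). *)
Lemma circle_sum_le {R : realType} n (x c s : R) : (0 < n)%N -> 0 <= x <= 1 ->
  c ^+ 2 + s ^+ 2 = 1 ->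
  let d := Delta n x in
  let a := Num.sqrt ((x + d * c) ^+ 2 + (d * s) ^+ 2) in
  let b := Num.sqrt ((1 - (x + d * c)) ^+ 2 + (d * s) ^+ 2) in
  [/\ a <= x + d, b <= 1 - x + d, 1 <= a + b & a + b <= 1 + 2 / n%:R].
Proof.
move=> n0 x01 cs d a b; have [x0 x1] := andP x01.
have d0 : 0 < d := Delta_gt0 x n0.
have nR : 0 < n%:R :> R by rewrite ltr0n.
have c1 : - 1 <= c <= 1 by apply/andP; split; nra.
have [cm cM] := andP c1.
have aE : (x + d * c) ^+ 2 + (d * s) ^+ 2 = x ^+ 2 + 2 * x * d * c + d ^+ 2.
  by rewrite -[X in _ = _ + X]mulr1 -[X in d ^+ 2 * X]cs; ring.
have bE : (1 - (x + d * c)) ^+ 2 + (d * s) ^+ 2 = (1 - x) ^+ 2 - 2 * (1 - x) * d * c + d ^+ 2.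
  by rewrite -[X in _ = _ + X]mulr1 -[X in d ^+ 2 * X]cs; ring.
have x1' : 0 <= 1 - x by rewrite subr_ge0.
have ha : a <= x + d.
  apply: sqrt_le_of_sq; first by rewrite addr_ge0 // ltW.
  rewrite aE; have : 0 <= x * d * (1 - c) by rewrite !mulr_ge0 ?(ltW d0) ?subr_ge0.
  by move=> h; nra.
have hb : b <= 1 - x + d.
  apply: sqrt_le_of_sq; first by rewrite addr_ge0 // ltW.
  rewrite bE; have : 0 <= (1 - x) * d * (1 + c).
    by rewrite !mulr_ge0 ?(ltW d0) //; lra.
  by move=> h; nra.
have sq_ge (u v : R) : u <= Num.sqrt (u ^+ 2 + v ^+ 2).
  apply: (le_trans (ler_norm u)); rewrite -sqrtr_sqr ler_wsqrtr // lerDl sqr_ge0 //.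
split=> //.
  by have := sq_ge (x + d * c) (d * s); have := sq_ge (1 - (x + d * c)) (d * s);
    rewrite -/a -/b => h1 h2; lra.
have [le|lt] := leP (Num.sqrt (x * (1 - x) / n%:R)) n%:R^-1.
  have dE : d = n%:R^-1 by rewrite /d /Delta max_r.
  by rewrite dE in ha hb; lra.
have d2 : d ^+ 2 = x * (1 - x) / n%:R.
  rewrite /d /Delta max_l ?(ltW lt) // sqr_sqrtr // divr_ge0 ?mulr_ge0 //.
have w0 : 0 < x * (1 - x).
  have : 0 < d ^+ 2 by rewrite exprn_gt0.
  by rewrite d2 pmulr_lgt0 // invr_gt0.
have xp : 0 < x by nra.
have xp' : 0 < 1 - x by nra.
have ha' : a <= x + d * c + d ^+ 2 / (2 * x).
  by rewrite /a aE; apply: sqrt_circle_le => //; exact: ltW.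
have hb' : b <= 1 - x + d * (- c) + d ^+ 2 / (2 * (1 - x)).
  rewrite /b bE -[_ - 2 * (1 - x) * d * c]/(_ + - (2 * (1 - x) * d * c)) -mulrN.
  by apply: sqrt_circle_le => //; [lra | exact: ltW].
have e : d ^+ 2 / (2 * x) + d ^+ 2 / (2 * (1 - x)) = n%:R^-1 / 2.
  by rewrite d2; field; rewrite !gt_eqF.
have : 0 < n%:R^-1 :> R by rewrite invr_gt0.
by lra.
Qed.

Lemma horner_bern {R : numFieldType} n k (x : R) :
  (bern n k).[x] = 'C(n, k)%:R * (x ^+ k * (1 - x) ^+ (n - k)).
Proof. by rewrite /bern hornerZ hornerM hornerXn horner_exp !hornerE. Qed.

Lemma map_bern {R C : numFieldType} (h : {rmorphism R -> C}) n k :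
  map_poly h (bern n k) = bern n k.
Proof.
by rewrite /bern map_polyZ rmorphM !rmorphXn rmorph_nat rmorphB /= map_polyX rmorph1.
Qed.

Lemma horner_bern_sum_hom {R : realFieldType} n (c : nat -> R) (a b : R) : a + b != 0 ->
  \sum_(k < n.+1) c k * ('C(n, k)%:R * (a ^+ k * b ^+ (n - k))) =
  (a + b) ^+ n * (\sum_(k < n.+1) c k *: bern n k).[a / (a + b)].
Proof.
move=> ab0; rewrite horner_sum mulr_sumr; apply: eq_bigr => k _.
rewrite hornerZ /bern hornerZ hornerM hornerXn horner_exp.
have -> : (1 - 'X : {poly R}).[a / (a + b)] = b / (a + b) by rewrite !hornerE; field.
have -> : (a + b) ^+ n = (a + b) ^+ k * (a + b) ^+ (n - k).
  by rewrite -exprD subnKC // -ltnS.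
by rewrite !expr_div_n; field; rewrite !expf_neq0.
Qed.

(** The triangle inequality in the Bernstein basis: nonnegative coefficients let
one replace Z and 1 - Z by their moduli, and homogeneity brings the pair of
moduli back to the unit interval. *)
Lemma cone_circle_le {R : realType} n (p : {poly R}) (x d : R) (z : R[i]) :
  bernstein_cone n p ->
  let Z := (real_complex R x + real_complex R d * z) in
  let a := Num.sqrt ((x + d * complex.Re z) ^+ 2 + (d * complex.Im z) ^+ 2) in
  let b := Num.sqrt ((1 - (x + d * complex.Re z)) ^+ 2 + (d * complex.Im z) ^+ 2) in
  a + b != 0 ->
  `|(map_poly (real_complex R) p).[Z]| <=
    real_complex R ((a + b) ^+ n * p.[a / (a + b)]).
Proof.
move=> /cone_bcoefP[sp p0] Z a b ab0.
have aE : `|Z| = real_complex R a.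
  rewrite normc_def /a /Z; case: (z) => c s /=.
  by rewrite !mul0r subr0 add0r addr0.
have bE : `|1 - Z| = real_complex R b.
  rewrite normc_def /b /Z; case: (z) => c s /=.
  by rewrite !mul0r subr0 !add0r addr0 sqrrN.
rewrite (bern_expansion sp) -(horner_bern_sum_hom n (fun k => bcoef n k p) ab0).
rewrite raddf_sum horner_sum (raddf_sum (real_complex R)).
apply: (le_trans (ler_norm_sum _ _ _)); apply: ler_sum => k _ /=.
have ck := p0 k (ltn_ord k).
rewrite map_polyZ map_bern hornerZ horner_bern !normrM !normrX aE bE normr_nat.
rewrite !rmorphM !rmorphXn /= rmorph_nat normc_def /= expr0n addr0 sqrtr_sqr.
by rewrite (ger0_norm ck).
Qed.

Lemma cone_deriv_le {R : realType} i (alpha : R) : 0 <= alpha ->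
  exists2 C : R, 0 <= C & forall n (p : {poly R}) (K x : R), (0 < n)%N ->
  bernstein_cone n p -> 0 <= K ->
  (forall y, 0 <= y <= 1 -> p.[y] <= K * Delta n y `^ alpha) -> 0 <= x <= 1 ->
  `|p^`(i).[x]| * Delta n x ^+ i <= C * K * Delta n x `^ alpha.
Proof.
move=> alpha0; exists (i`!%:R * (expR 2 * 2 `^ alpha)).
  by rewrite mulr_ge0 // mulr_ge0 ?expR_ge0 ?powR_ge0.
move=> n p K x n0 pc K0 pK x01; have D0 := Delta_gt0 x n0.
have [x0 x1] := andP x01.
have nR : 0 < n%:R :> R by rewrite ltr0n.
set d := Delta n x in D0 *.
pose c k := p^`(k).[x] / k`!%:R * d ^+ k.
have iR : 0 < i`!%:R :> R by rewrite ltr0n fact_gt0.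
suff : `|c i| <= expR 2 * 2 `^ alpha * K * d `^ alpha.
  have -> : `|p^`(i).[x]| * d ^+ i = i`!%:R * `|c i|.
    rewrite /c !normrM normfV (gtr0_norm iR) (ger0_norm (exprn_ge0 _ (ltW D0))).
    by field; rewrite gt_eqF.
  by move=> h; apply: le_trans (ler_wpM2l (ltW iR) h) _; rewrite !mulrA.
have [sp _] := (cone_bcoefP n p).1 pc.
have sp' : (size p <= n.+1 + i)%N by rewrite (leq_trans sp) // leq_addr.
set B := expR 2 * 2 `^ alpha * K * d `^ alpha.
rewrite -lecR -[real_complex R `|c i|]/(`|c i|%:C)%C.
have -> : real_complex R `|c i| = `|real_complex R (c i)|.
  by rewrite normc_def /= expr0n addr0 sqrtr_sqr.
apply: (@cauchy_coef_le _ (n.+1 + i)%N (fun k => real_complex R (c k))); last by lia.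
move=> z z1.
have cs : complex.Re z ^+ 2 + complex.Im z ^+ 2 = 1.
  have : Num.sqrt (complex.Re z ^+ 2 + complex.Im z ^+ 2) = 1.
    by apply: complexI; rewrite -normc_def z1.
  move=> h; rewrite -(@sqr_sqrtr _ (complex.Re z ^+ 2 + complex.Im z ^+ 2)) ?h ?expr1n //.
  by rewrite addr_ge0 ?sqr_ge0.
have -> : \sum_(k < n.+1 + i) real_complex R (c k) * z ^+ k =
    (map_poly (real_complex R) p).[real_complex R x + real_complex R d * z].
  rewrite [in RHS](poly_taylor x sp') raddf_sum horner_sum; apply: eq_bigr => k _ /=.
  rewrite map_polyZ hornerZ rmorphXn /= rmorphB /= map_polyX map_polyC /= horner_exp.
  by rewrite hornerXsubC addrAC subrr add0r exprMn mulrA -rmorphXn -rmorphM.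
have [] := circle_sum_le n0 x01 cs; rewrite -/d.
set a := Num.sqrt _; set b := Num.sqrt _ => ha hb ab1 ab2.
have ab0 : 0 < a + b by apply: lt_le_trans ab1.
have hc := @cone_circle_le R n p x d z pc; rewrite /= -/a -/b in hc.
apply: (le_trans (hc (lt0r_neq0 ab0))); rewrite lecR.
have a0 : 0 <= a by exact: sqrtr_ge0.
have b0 : 0 <= b by exact: sqrtr_ge0.
have u01 : 0 <= a / (a + b) <= 1.
  by rewrite divr_ge0 ?(ltW ab0) //= ler_pdivrMr // mul1r lerDl.
have hp : (a + b) ^+ n <= expR 2.
  apply: (@le_trans _ _ (expR (2 / n%:R) ^+ n)).
    by apply: lerXn2r; rewrite ?nnegrE ?expR_ge0 ?(ltW ab0) // (le_trans ab2) // expR_ge1Dx.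
  by rewrite -expRM_natl mulrC mulfVK ?gt_eqF.
have hD : Delta n (a / (a + b)) <= 2 * d.
  rewrite -(@ler_pXn2r _ 2) ?nnegrE ?mulr_ge0 ?(ltW D0) //; last exact/ltW/Delta_gt0.
  have hi := Delta_ge_inv n x; rewrite -/d in hi.
  have hw := var_le_Delta_sq n x01; rewrite -/d in hw.
  have inv0 : 0 < n%:R^-1 :> R by rewrite invr_gt0.
  have d1 : d <= 1 := Delta_le1 n0 x01.
  rewrite Delta_sq // ge_max; apply/andP; split; last first.
    by rewrite ler_pXn2r ?nnegrE ?mulr_ge0 ?(ltW D0) ?(ltW inv0) //; lra.
  have hab : a / (a + b) * (1 - a / (a + b)) <= x * (1 - x) + d + d ^+ 2.
    have -> : 1 - a / (a + b) = b / (a + b) by field; rewrite gt_eqF.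
    apply: (@le_trans _ _ (a * b)).
      by apply: ler_pM; rewrite ?divr_ge0 ?(ltW ab0) // ler_pdivrMr // ler_peMr.
    apply: (le_trans (ler_pM a0 b0 ha hb)).
    by rewrite le_eqVlt; apply/orP; left; apply/eqP; ring.
  apply: (le_trans (ler_wpM2r (ltW inv0) hab)).
  have h2 : d * n%:R^-1 <= d ^+ 2 by rewrite expr2 ler_wpM2l // ltW.
  have h3 : d ^+ 2 * n%:R^-1 <= d ^+ 2.
    by rewrite -[leRHS]mulr1 ler_wpM2l ?sqr_ge0 // invf_le1 // ler1n.
  have -> : (2 * d) ^+ 2 = 4 * d ^+ 2 by ring.
  rewrite (mulrDl _ (d ^+ 2)) mulrDl; have := sqr_ge0 d; lra.
have p0 := cone_horner_ge0 pc u01.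
apply: (@le_trans _ _ (expR 2 * (K * (2 * d) `^ alpha))).
  apply: ler_pM => //; first by rewrite exprn_ge0 // ltW.
  apply: (le_trans (pK _ u01)); rewrite ler_wpM2l //.
  apply: ge0_ler_powR; rewrite ?nnegrE ?mulr_ge0 ?(ltW D0) //.
  exact/ltW/Delta_gt0.
rewrite /B powRM ?(ltW D0) // le_eqVlt; apply/orP; left; apply/eqP; ring.
Qed.

(** * Derivatives on the closed unit interval *)

(** The derivative within the unit interval, one-sided at its end points, with
the division cleared; only values at points of the interval occur. *)
Definition deriv_on01 {R : realType} (f f' : R -> R) : Prop :=
  forall x, 0 <= x <= 1 -> forall e, 0 < e -> exists2 d, 0 < d &
  forall y, 0 <= y <= 1 -> `|y - x| < d ->
    `|f y - f x - (y - x) * f' x| <= e * `|y - x|.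

Lemma deriv_on01B {R : realType} (f f' g g' : R -> R) :
  deriv_on01 f f' -> deriv_on01 g g' ->
  deriv_on01 (fun x => f x - g x) (fun x => f' x - g' x).
Proof.
move=> Hf Hg x x01 e e0.
have e20 : 0 < e / 2 by rewrite divr_gt0.
have [d1 d10 H1] := Hf x x01 _ e20; have [d2 d20 H2] := Hg x x01 _ e20.
exists (Num.min d1 d2) => [|y y01]; first by rewrite lt_min d10.
rewrite lt_min => /andP[yd1 yd2].
have := H1 y y01 yd1; have := H2 y y01 yd2.
have -> : f y - g y - (f x - g x) - (y - x) * (f' x - g' x) =
  (f y - f x - (y - x) * f' x) - (g y - g x - (y - x) * g' x) by ring.
move=> h2 h1; apply: (le_trans (ler_normB _ _)); lra.
Qed.

Lemma deriv_on01_poly {R : realType} (p : {poly R}) :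
  deriv_on01 (horner p) (horner p^`()).
Proof.
move=> x x01 e e0.
have [-> | p0] := eqVneq p 0.
  by exists 1 => // y _ _; rewrite derivC !horner0 mulr0 !subr0 normr0 mulr_ge0 // ltW.
have sp : (size p <= (size p).+2)%N by rewrite leqW.
pose c k := p^`(k.+2).[x] / k.+2`!%:R.
pose B := \sum_(k < size p) `|c k|.
have B0 : 0 <= B by apply: sumr_ge0.
have B1 : 0 < B + 1 by rewrite ltr_wpDl.
exists (Num.min 1 (e / (B + 1))) => [|y y01]; first by rewrite lt_min ltr01 divr_gt0.
rewrite lt_min => /andP[h1 h2].
rewrite {1}(poly_taylor x sp) horner_sum !big_ord_recl /= !hornerZ !horner_exp hornerXsubC.
rewrite expr0 !divr1 mulr1.
set S := \sum_(i < _) _.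
have SE : S = \sum_(k < size p) c k * (y - x) ^+ k.+2.
  by apply: eq_bigr => k _; rewrite hornerZ horner_exp hornerXsubC.
have -> : (y - x) ^+ bump 0 0 = y - x by [].
have -> : p.[x] + (p^`().[x] * (y - x) + S) - p.[x] - (y - x) * p^`().[x] = S by ring.
apply: (@le_trans _ _ (B * `|y - x| ^+ 2)).
  rewrite SE; apply: (le_trans (ler_norm_sum _ _ _)).
  rewrite /B mulr_suml; apply: ler_sum => k _; rewrite normrM normrX.
  rewrite ler_wpM2l // exprS exprS expr2 mulrA ler_piMr ?mulr_ge0 //.
  by rewrite exprn_ile1 // ltW.
rewrite expr2 mulrA ler_wpM2r //.
apply: (@le_trans _ _ ((B + 1) * `|y - x|)); first by rewrite ler_wpM2r // lerDl.
by rewrite mulrC -ler_pdivlMr // ltW.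
Qed.

Lemma deriv_on01_is_derive {R : realType} (f f' : R -> R) (x : R) : deriv_on01 f f' ->
  0 < x < 1 -> is_derive x 1 f (f' x).
Proof.
move=> Hf /andP[x0 x1].
have x01 : 0 <= x <= 1 by rewrite !ltW.
suff H : (fun h => h^-1 *: ((f \o shift x) (h *: 1) - f x)) @ 0^' --> f' x.
  split; first by apply/cvg_ex; exists (f' x).
  exact: cvg_lim H.
apply/cvgrPdist_le => e e0.
have [d d0 Hd] := Hf x x01 e e0.
pose d' := Num.min d (Num.min x (1 - x)).
have d'0 : 0 < d' by rewrite !lt_min d0 x0 subr_gt0.
exists d' => //= h; rewrite /= sub0r normrN !lt_min => /and3P[hd hx hx1] h0.
have y01 : 0 <= x + h <= 1.
  by move: hx hx1; rewrite !ltr_norml => /andP[? ?] /andP[? ?]; apply/andP; split; lra.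
have := Hd _ y01; rewrite addrAC subrr add0r => /(_ hd).
rewrite /shift /= -[h *: 1]/(h * 1) mulr1 (addrC h).
have hn : 0 < `|h| by rewrite normr_gt0.
rewrite -ler_pdivrMr // -normfV -normrM => H.
rewrite -normrN opprB; apply: le_trans H; rewrite le_eqVlt; apply/orP; left; apply/eqP.
by congr `|_|; rewrite -[_ *: _]/(_ * _); field.
Qed.

Lemma deriv_on01_continuous {R : realType} (f f' : R -> R) (x e : R) : deriv_on01 f f' ->
  0 <= x <= 1 -> 0 < e -> exists2 d, 0 < d &
  forall y, 0 <= y <= 1 -> `|y - x| < d -> `|f y - f x| <= e.
Proof.
move=> Hf x01 e0; have [d d0 Hd] := Hf x x01 1 ltr01.
have B0 : 0 < `|f' x| + 1 by rewrite ltr_wpDl.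
exists (Num.min d (e / (`|f' x| + 1))) => [|y y01]; first by rewrite lt_min d0 divr_gt0.
rewrite lt_min => /andP[yd ye].
have := Hd y y01 yd; rewrite mul1r => h.
have -> : f y - f x = (f y - f x - (y - x) * f' x) + (y - x) * f' x by ring.
apply: (le_trans (ler_normD _ _)); rewrite normrM.
apply: (@le_trans _ _ (`|y - x| * (`|f' x| + 1))); first by rewrite mulrDr mulr1 addrC lerD.
by rewrite -ler_pdivlMr // ltW.
Qed.

Lemma within01_continuous {R : realType} (f : R -> R) (a b : R) : 0 <= a -> b <= 1 ->
  (forall x e, 0 <= x <= 1 -> 0 < e -> exists2 d, 0 < d &
     forall y, 0 <= y <= 1 -> `|y - x| < d -> `|f y - f x| <= e) ->
  {within `[a, b], continuous f}.
Proof.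
move=> a0 b1 Hf; apply/subspace_continuousP => x /=; rewrite in_itv /= => /andP[ax xb].
have x01 : 0 <= x <= 1 by rewrite (le_trans a0) // (le_trans xb).
apply/cvgrPdist_le => e e0; have [d d0 Hd] := Hf x e x01 e0.
exists d => //= y /= xyd; rewrite in_itv /= => /andP[ay yb].
by rewrite distrC Hd // ?(le_trans a0) ?(le_trans yb) // distrC.
Qed.

(** The bound on the derivative is required only between x and y, which the two
hypotheses on distances express for both orders of x and y. *)
Lemma deriv_on01_mvi {R : realType} (f f' : R -> R) (B x y : R) : deriv_on01 f f' ->
  0 <= x <= 1 -> 0 <= y <= 1 ->
  (forall z, 0 <= z <= 1 -> `|z - x| <= `|y - x| -> `|z - y| <= `|y - x| -> `|f' z| <= B) ->
  `|f y - f x| <= B * `|y - x|.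
Proof.
move=> Hf.
have main a b : a < b -> 0 <= a -> b <= 1 ->
    (forall z, a <= z <= b -> `|f' z| <= B) -> `|f b - f a| <= B * `|b - a|.
  move=> ab a0 b1 HB.
  have d z : z \in `]a, b[ -> is_derive z 1 f (f' z).
    rewrite in_itv /= => /andP[az zb]; apply: deriv_on01_is_derive => //.
    by rewrite (le_lt_trans a0) // (lt_le_trans zb).
  have c : {within `[a, b], continuous f}.
    by apply: within01_continuous => // z e z01 e0; exact: (deriv_on01_continuous Hf z01 e0).
  have [z] := MVT ab d c; rewrite in_itv /= => /andP[az zb] ->.
  by rewrite normrM ler_wpM2r // HB // !ltW.
move=> /andP[x0 x1] /andP[y0 y1] HB.
have [xy|yx|->] := ltgtP x y; last by rewrite !subrr normr0 mulr0.
  apply: main => // z /andP[xz zy]; apply: HB.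
  - by rewrite (le_trans x0) // (le_trans zy).
  - by rewrite !ger0_norm; lra.
  by rewrite distrC !ger0_norm; lra.
rewrite distrC [X in _ * X]distrC; apply: main => // z /andP[yz zx]; apply: HB.
- by rewrite (le_trans y0) // (le_trans zx).
- by rewrite distrC [leRHS]distrC !ger0_norm; lra.
by rewrite [leRHS]distrC !ger0_norm; lra.
Qed.

Lemma punctured01_proper {R : realType} (x : R) : 0 <= x <= 1 ->
  ProperFilter (within `[0, 1] x^').
Proof.
move=> /andP[x0 x1]; split; last exact: within_filter.
move=> [e /= e0 He].
pose d := Num.min (e / 2) 4^-1.
have d0 : 0 < d by rewrite lt_min divr_gt0 //= invr_gt0.
have [de d4] : d <= e / 2 /\ d <= 4^-1 by rewrite /d; split; rewrite ge_min lexx ?orbT.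
have [xs|xl] := leP x (1 / 2).
  apply: (He (x + d)) => /=.
  - by rewrite opprD addNKr normrN gtr0_norm //; lra.
  - by rewrite -subr_eq0 addrAC subrr add0r gt_eqF.
  - by rewrite in_itv /=; apply/andP; split; lra.
apply: (He (x - d)) => /=.
- by rewrite opprB addrC subrK gtr0_norm //; lra.
- by rewrite -subr_eq0 addrAC subrr add0r oppr_eq0 gt_eqF.
- by rewrite in_itv /=; apply/andP; split; lra.
Qed.

Lemma derive01P {R : realType} (f f' : R -> R) : deriv_on01 f f' ->
  forall x, 0 <= x <= 1 -> derivable01 f x /\ derive01 f x = f' x.
Proof.
move=> Hf x x01; have PF := punctured01_proper x01.
suff H : diffquot01 f x y @[y --> within `[0, 1] x^'] --> f' x.
  by split; [apply/cvg_ex; exists (f' x) | exact: cvg_lim H].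
apply/cvgrPdist_le => e e0; have [d d0 Hd] := Hf x x01 e e0.
exists d => //= y /= xyd yx; rewrite in_itv /= => y01.
rewrite distrC in xyd; have := Hd y y01 xyd.
have yx0 : y - x != 0 by rewrite subr_eq0.
rewrite -ler_pdivrMr ?normr_gt0 // -normfV -normrM => H.
rewrite distrC; apply: le_trans H; rewrite /diffquot01.
by rewrite le_eqVlt; apply/orP; left; apply/eqP; congr `|_|; field.
Qed.

Lemma derivable01_deriv_on01 {R : realType} (f : R -> R) :
  (forall x, 0 <= x <= 1 -> derivable01 f x) -> deriv_on01 f (derive01 f).
Proof.
move=> Hf x x01 e e0; have PF := punctured01_proper x01.
have /cvgrPdist_le/(_ e e0)[d /= d0 Hd] := Hf x x01.
exists d => // y y01 yxd; have [->|yx] := eqVneq y x.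
  by rewrite !subrr mul0r subr0 normr0 mulr0.
have := Hd y; rewrite /= distrC => /(_ yxd yx); rewrite in_itv /= => /(_ y01).
have yx0 : y - x != 0 by rewrite subr_eq0.
rewrite -/(derive01 f x) distrC -(ler_pM2r (_ : 0 < `|y - x|)) ?normr_gt0 // -normrM.
apply: le_trans; rewrite /diffquot01 le_eqVlt; apply/orP; left; apply/eqP.
by congr `|_|; field.
Qed.

(** * Taylor remainders of functions in the Hoelder class *)

(** A distance that is not small is covered by m small steps. *)
Lemma holder_global {R : realType} (g : R -> R) (b K h0 : R) : 0 <= b -> 0 <= K -> 0 < h0 ->
  (forall h x y, 0 < h < h0 -> 0 <= x <= 1 -> 0 <= y <= 1 -> `|x - y| < h ->
     `|g x - g y| <= K * h `^ b) ->
  exists2 K', 0 <= K' & forall x y, 0 <= x <= 1 -> 0 <= y <= 1 ->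
     `|g x - g y| <= K' * `|x - y| `^ b.
Proof.
move=> b0 K0 h00 H.
pose m := (Num.bound (2 / h0)).+1.
have mh : 2 / h0 < m%:R.
  have := @archi_boundP R (2 / h0) (divr_ge0 (ler0n _ _) (ltW h00)).
  by move/lt_le_trans; apply; rewrite ler_nat.
have mR : 0 < m%:R :> R by rewrite ltr0n.
exists (m%:R * (K * 2 `^ b)); first by rewrite !mulr_ge0 ?powR_ge0.
move=> x y /andP[x0 x1] /andP[y0 y1].
have [->|xy] := eqVneq x y.
  by rewrite !subrr normr0 mulr_ge0 ?powR_ge0 // !mulr_ge0 ?powR_ge0.
have d0 : 0 < `|x - y| by rewrite normr_gt0 subr_eq0.
have d1 : `|x - y| <= 1 by rewrite ler_norml; apply/andP; split; lra.
(* m equal steps from y to x, each shorter than h0 / 2 *)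
pose t k := y + (x - y) * (k%:R / m%:R).
have t01 k : (k <= m)%N -> 0 <= t k <= 1.
  move=> lekm; rewrite /t.
  have : k%:R / m%:R <= 1 :> R by rewrite ler_pdivrMr // mul1r ler_nat.
  have : 0 <= k%:R / m%:R :> R by rewrite divr_ge0.
  move: (k%:R / m%:R) => s s0 s1.
  have h1 : 0 <= s * x by rewrite mulr_ge0.
  have h2 : 0 <= (1 - s) * y by rewrite mulr_ge0 // subr_ge0.
  have h3 : 0 <= s * (1 - x) by rewrite mulr_ge0 // subr_ge0.
  have h4 : 0 <= (1 - s) * (1 - y) by rewrite mulr_ge0 // subr_ge0.
  by apply/andP; split; nra.
have step k : (k < m)%N -> `|g (t k.+1) - g (t k)| <= K * (2 * `|x - y|) `^ b.
  move=> ltkm.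
  have tE : t k.+1 - t k = (x - y) / m%:R.
    by rewrite /t -natr1; field; rewrite gt_eqF.
  have dm : `|t k.+1 - t k| < 2 * (`|x - y| / m%:R).
    rewrite tE normrM normfV normr_nat.
    have : 0 < `|x - y| / m%:R by rewrite divr_gt0.
    by lra.
  have hh : 0 < 2 * (`|x - y| / m%:R) < h0.
    rewrite mulr_gt0 ?divr_gt0 //= mulrA ltr_pdivrMr //.
    rewrite (le_lt_trans (_ : _ <= 2)) //; first by lra.
    by rewrite mulrC -ltr_pdivrMr.
  apply: (le_trans (H _ _ _ hh (t01 _ ltkm) (t01 _ (ltnW ltkm)) dm)).
  rewrite ler_wpM2l //; apply: ge0_ler_powR; rewrite ?nnegrE ?mulr_ge0 ?divr_ge0 ?ler0n //.
  rewrite ler_wpM2l // ler_pdivrMr // -[leLHS]mulr1 ler_wpM2l // ler1n //.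
have -> : g x - g y = \sum_(k < m) (g (t k.+1) - g (t k)).
  rewrite -(big_mkord xpredT (fun k => g (t k.+1) - g (t k))) telescope_sumr // /t mul0r.
  by rewrite mulfV ?gt_eqF // mulr1 mulr0 addr0 [y + _]addrC subrK.
apply: (le_trans (ler_norm_sum _ _ _)).
apply: (@le_trans _ _ (\sum_(k < m) K * (2 * `|x - y|) `^ b)).
  by apply: ler_sum => k _; exact: step.
by rewrite sumr_const card_ord -[leLHS]mulr_natl powRM // !mulrA.
Qed.

Lemma truncn_nonint {R : realType} (alpha : R) : 0 < alpha -> alpha \isn't a Num.int ->
  (Num.truncn alpha)%:R < alpha < (Num.truncn alpha)%:R + 1.
Proof.
move=> a0 aint; have /andP[h1 h2] := @truncn_itv R alpha (ltW a0).
rewrite natr1 h2 andbT lt_neqAle h1 andbT.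
by apply: contra aint => /eqP <-; exact: rpred_nat.
Qed.

Lemma holder01_bound {R : realType} (alpha : R) (f : R -> R) : 0 < alpha ->
  alpha \isn't a Num.int -> holder01 alpha f ->
  let r := Num.truncn alpha in
  exists2 K, 0 <= K & forall x y, 0 <= x <= 1 -> 0 <= y <= 1 ->
     `|derive01n r f x - derive01n r f y| <= K * `|x - y| `^ (alpha - r%:R).
Proof.
move=> a0 aint [_ [K]] HK r; have /andP[ra _] := truncn_nonint a0 aint.
have b0 : 0 <= alpha - r%:R by rewrite subr_ge0 ltW.
case: HK => h0 /= h00 Hh.
apply: (@holder_global _ _ (alpha - r%:R) `|K| h0) => // h x y /andP[hp hh0] x01 y01 xy.
have := Hh h; rewrite /= sub0r normrN gtr0_norm // => /(_ hh0).
move=> /(_ hp) hm.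
have hle : (`|derive01n r f x - derive01n r f y|%:E <= modulus01 (derive01n r f) h)%E.
  by apply: ereal_sup_ubound; exists x, y; split; rewrite // in_itv.
rewrite -lee_fin (le_trans hle) // (le_trans hm) //.
by rewrite lee_fin ler_wpM2r ?powR_ge0 // ler_norm.
Qed.

(** Descending induction on i: the remainder of order i vanishes at x and its
derivative is the remainder of order i + 1. *)
Lemma holder_jet_of_deriv {R : realType} r (alpha K : R) (F : nat -> R -> R) :
  0 <= K -> r%:R < alpha ->
  (forall i, (i < r)%N -> deriv_on01 (F i) (F i.+1)) ->
  (forall x y, 0 <= x <= 1 -> 0 <= y <= 1 ->
     `|F r x - F r y| <= K * `|x - y| `^ (alpha - r%:R)) ->
  holder_jet r alpha K F.
Proof.
move=> K0 ra HF Hr i x y + x01.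
elim: {i}(r - i)%N {-2}i (erefl (r - i)%N) y => [|j IHj] i e y leir y01.
  have -> : i = r by apply/eqP; rewrite eqn_leq leir -subn_eq0 e.
  have /size1_polyC -> : (size (taylor r F x)^`(r) <= 1)%N.
    apply/leq_sizeP => k k0; rewrite coef_derivn nth_default ?mul0rn //.
    by rewrite (leq_trans (size_taylor _ _ _)) // -addn1 leq_add2l.
  rewrite hornerC -[(_)`_0](hornerC _ x) -size1_polyC; last first.
    apply/leq_sizeP => k k0; rewrite coef_derivn nth_default ?mul0rn //.
    by rewrite (leq_trans (size_taylor _ _ _)) // -addn1 leq_add2l.
  by rewrite taylor_derivn_center //; exact: Hr.
have ltir : (i < r)%N by lia.
pose phi z := F i z - (taylor r F x)^`(i).[z].
pose phi' z := F i.+1 z - (taylor r F x)^`(i.+1).[z].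
have Hphi : deriv_on01 phi phi'.
  apply: deriv_on01B; first exact: HF.
  by rewrite derivnS; exact: deriv_on01_poly.
have phix : phi x = 0 by rewrite /phi taylor_derivn_center // subrr.
have a0 : 0 <= alpha - i.+1%:R.
  by rewrite subr_ge0 (le_trans _ (ltW ra)) // ler_nat.
have := deriv_on01_mvi (B := K * `|y - x| `^ (alpha - i.+1%:R)) Hphi x01 y01.
rewrite phix subr0 => /(_ _)/le_trans; apply.
  move=> z z01 zx _; apply: (le_trans (IHj i.+1 _ z ltir z01)); first by lia.
  by rewrite ler_wpM2l // ge0_ler_powR ?nnegrE.
have [->|yx] := eqVneq y x.
  by rewrite subrr normr0 mulr0 mulr_ge0 ?powR_ge0.
have d0 : 0 < `|y - x| by rewrite normr_gt0 subr_eq0.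
rewrite -mulrA -{2}(powRr1 (ltW d0)) -powRD ?(gt_eqF d0) ?implybT //.
by rewrite -natr1 opprD addrA subrK.
Qed.

Lemma holder_jet_of_holder01 {R : realType} (alpha : R) (f : R -> R) : 0 < alpha ->
  alpha \isn't a Num.int -> holder01 alpha f ->
  let r := Num.truncn alpha in
  exists2 K, 0 <= K & holder_jet r alpha K (fun i => derive01n i f).
Proof.
move=> a0 aint Hf r; have [K K0 HK] := holder01_bound a0 aint Hf.
have /andP[ra _] := truncn_nonint a0 aint.
exists K => //; apply: holder_jet_of_deriv => // i ltir.
apply: derivable01_deriv_on01 => x x01; case: Hf => Hd _.
by apply: Hd => //; rewrite in_itv.
Qed.

Lemma poly_bound01 {R : realType} (p : {poly R}) : exists2 B, 0 <= B &
  forall x, 0 <= x <= 1 -> `|p.[x]| <= B.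
Proof.
exists (\sum_(i < size p) `|p`_i|); first exact: sumr_ge0.
move=> x /andP[x0 x1]; rewrite horner_coef (le_trans (ler_norm_sum _ _ _)) //.
apply: ler_sum => i _; rewrite normrM normrX (ger0_norm x0) ler_piMr //.
by rewrite exprn_ile1.
Qed.

Lemma holder_jet_bounded {R : realType} r (alpha K : R) (F : nat -> R -> R) :
  r%:R < alpha -> 0 <= K -> holder_jet r alpha K F ->
  exists Kb, forall i x, (i <= r)%N -> 0 <= x <= 1 -> `|F i x| <= Kb.
Proof.
move=> ra K0 HF.
have /choice[B HB] : forall i, exists B, forall x : R, 0 <= x <= 1 ->
    `|(taylor r F 0)^`(i).[x]| <= B.
  by move=> i; have [B _ HB] := poly_bound01 (taylor r F 0)^`(i); exists B.
exists (K + \sum_(i < r.+1) `|B i|) => i x leir x01.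
have h0 : 0 <= (0 : R) <= 1 by rewrite lexx ler01.
have -> : F i x = (F i x - (taylor r F 0)^`(i).[x]) + (taylor r F 0)^`(i).[x].
  by rewrite subrK.
apply: (le_trans (ler_normD _ _)); apply: lerD.
  apply: (le_trans (HF i 0 x leir h0 x01)); rewrite subr0 ler_piMr //.
  have /andP[x0 x1] := x01; rewrite ger0_norm //.
  rewrite -[leRHS](_ : 1 `^ (alpha - i%:R) = 1); last by rewrite powR1.
  apply: ge0_ler_powR; rewrite ?nnegrE ?ler01 //.
  by rewrite subr_ge0 (le_trans _ (ltW ra)) // ler_nat.
rewrite (bigD1 (Ordinal (leir : (i < r.+1)%N))) //= (le_trans (HB i x x01)) //.
by rewrite (le_trans (ler_norm _)) // lerDl sumr_ge0.
Qed.

Lemma holder_jet_pos_min {R : realType} r (alpha K : R) (F : nat -> R -> R) :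
  0 < alpha -> 0 <= K -> holder_jet r alpha K F ->
  (forall x, 0 <= x <= 1 -> 0 < F 0%N x) ->
  exists2 m, 0 < m & forall x, 0 <= x <= 1 -> m <= F 0%N x.
Proof.
move=> a0 K0 HF Fpos.
have cF : {within `[0, 1], continuous (F 0%N)}.
  apply: within01_continuous => // x e x01 e0.
  have e20 : 0 < e / 2 by rewrite divr_gt0.
  have [d1 d10 H1] := powR_small a0 K0 e20.
  have [d2 d20 H2] := deriv_on01_continuous (deriv_on01_poly (taylor r F x)) x01 e20.
  exists (Num.min d1 d2) => [|y y01]; first by rewrite lt_min d10.
  rewrite lt_min => /andP[yd1 yd2].
  have := H1 _ (normr_ge0 _) yd1; have := H2 y y01 yd2.
  have := HF 0%N x y (leq0n r) x01 y01; rewrite subr0 derivn0.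
  have := taylor_derivn_center F x (leq0n r); rewrite derivn0 => ->.
  set T := (taylor r F x).[y] => h1 h2 h3.
  have -> : F 0%N y - F 0%N x = (F 0%N y - T) + (T - F 0%N x) by ring.
  by apply: (le_trans (ler_normD _ _)); lra.
have [c] := EVT_min (ler01 : 0 <= 1 :> R) cF; rewrite in_itv /= => c01 Hc.
by exists (F 0%N c) => [|x x01]; [exact: Fpos | apply: Hc; rewrite in_itv].
Qed.

Lemma Bernstein_series_of_holder01 {R : realType} (alpha : R) (f : R -> R) : 0 < alpha ->
  alpha \isn't a Num.int -> (forall x, x \in `[0, 1] -> 0 < f x) -> holder01 alpha f ->
  exists F, Bernstein_series alpha f F.
Proof.
move=> a0 aint fpos Hf; have [K K0 HF] := holder_jet_of_holder01 a0 aint Hf.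
have /andP[ra _] := truncn_nonint a0 aint.
have [Kb HKb] := holder_jet_bounded ra K0 HF.
have [x x01|m m0 Hm] := holder_jet_pos_min a0 K0 HF; first by apply: fpos; rewrite in_itv.
exact: (Bernstein_series_of_jet a0 ra K0 HF m0 Hm HKb).
Qed.

(** * Sums over dyadic degrees *)

Lemma geometric_sum_le {R : realFieldType} (rho : R) m (a : nat -> R) : 0 <= rho < 1 ->
  (forall j, 0 <= a j) -> (forall j, a j.+1 <= rho * a j) ->
  \sum_(j < m) a j <= a 0%N / (1 - rho).
Proof.
move=> /andP[r0 r1] a0 aS; have r10 : 0 < 1 - rho by rewrite subr_gt0.
elim: m a a0 aS => [|m IHm] a a0 aS; first by rewrite big_ord0 divr_ge0 // ltW.
rewrite big_ord_recl; have h := IHm (fun j => a j.+1) (fun j => a0 _) (fun j => aS _).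
apply: (@le_trans _ _ (a 0%N + rho * a 0%N / (1 - rho))).
  by rewrite lerD2l (le_trans h) // ler_wpM2r ?invr_ge0 // ltW.
by rewrite le_eqVlt; apply/orP; left; apply/eqP; field; rewrite gt_eqF.
Qed.

(** The terms a j >= 1 and the terms a j < 1 form two geometric sums, one read
backwards.  In the induction the bound for a 0 >= 1 is
(2 - rho / a 0) / (1 - rho). *)
Lemma two_sided_geometric_sum_le {R : realFieldType} (rho : R) m (a : nat -> R) :
  0 < rho < 1 -> (forall j, 0 < a j) -> (forall j, a j.+1 <= rho * a j) ->
  \sum_(j < m) Num.min (a j) (a j)^-1 <= 2 / (1 - rho).
Proof.
move=> /andP[r0 r1]; have r10 : 0 < 1 - rho by rewrite subr_gt0.
have small n (b : nat -> R) : (forall j, 0 < b j) -> (forall j, b j.+1 <= rho * b j) ->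
    b 0%N < 1 -> \sum_(j < n) Num.min (b j) (b j)^-1 <= (1 - rho)^-1.
  move=> b0 bS b1; apply: (@le_trans _ _ (\sum_(j < n) b j)).
    by apply: ler_sum => j _; rewrite ge_min lexx.
  have hr : 0 <= rho < 1 by rewrite ltW.
  apply: (le_trans (geometric_sum_le n hr (fun j => ltW (b0 j)) bS)).
  by rewrite -[leRHS]mul1r ler_wpM2r ?invr_ge0 // ltW.
suff H : (forall j, 0 < a j) -> (forall j, a j.+1 <= rho * a j) -> 1 <= a 0%N ->
    \sum_(j < m) Num.min (a j) (a j)^-1 <= (2 - rho / a 0%N) / (1 - rho).
  move=> a0 aS; have [a1|a1] := ltP (a 0%N) 1.
    apply: (le_trans (small m a a0 aS a1)).
    by rewrite -[leLHS]mul1r ler_wpM2r ?invr_ge0 ?ltW // ltr1n.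
  apply: (le_trans (H a0 aS a1)); rewrite ler_wpM2r ?invr_ge0 ?(ltW r10) //.
  by rewrite gerBl divr_ge0 ?ltW.
elim: m a => [|m IHm] a a0 aS a1.
  rewrite big_ord0 divr_ge0 ?(ltW r10) // subr_ge0 ler_pdivrMr //.
  by nra.
have inv1 : (a 0%N)^-1 <= 1 by rewrite invf_le1.
have inv0 : 0 < (a 0%N)^-1 by rewrite invr_gt0.
rewrite big_ord_recl /= min_r; last by rewrite (le_trans inv1).
suff H : \sum_(i < m) Num.min (a (bump 0 i)) (a (bump 0 i))^-1 <=
    (2 - (a 0%N)^-1) / (1 - rho).
  apply: (le_trans (lerD (lexx _) H)).
  by rewrite le_eqVlt; apply/orP; left; apply/eqP; field; rewrite !gt_eqF.
have [b1|b1] := ltP (a 1%N) 1.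
  apply: (le_trans (small m (fun j => a j.+1) (fun j => a0 _) (fun j => aS _) b1)).
  by rewrite -[leLHS]mul1r ler_wpM2r ?invr_ge0 ?(ltW r10) //; lra.
apply: (le_trans (IHm (fun j => a j.+1) (fun j => a0 _) (fun j => aS _) b1)).
rewrite ler_wpM2r ?invr_ge0 ?(ltW r10) // lerD2l lerN2.
by rewrite ler_pdivlMr // mulrC ler_pdivrMr // [leRHS]mulrC.
Qed.

Definition dyadic_Delta {R : realType} J (x : R) : R := Delta (2 ^ J.+1) x.

Lemma dyadic_Delta_gt0 {R : realType} J (x : R) : 0 < dyadic_Delta J x.
Proof. by rewrite Delta_gt0 // expn_gt0. Qed.

Lemma half_powR_lt1 {R : realType} (g : R) : 0 < g -> 0 < (2^-1 : R) `^ g < 1.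
Proof.
move=> g0; rewrite powR_gt0 ?invr_gt0 //=.
rewrite -[ltRHS](_ : 1 `^ g = 1); last by rewrite powR1.
by apply: gt0_ltr_powR; rewrite ?nnegrE ?invr_ge0 //; lra.
Qed.

Lemma dyadic_Delta_step {R : realType} J (x g : R) : 0 <= x <= 1 -> 0 < g ->
  dyadic_Delta J.+1 x `^ g <= (2^-1) `^ (g / 2) * dyadic_Delta J x `^ g.
Proof.
move=> x01 g0.
have d0 K : 0 <= dyadic_Delta K x by exact/ltW/dyadic_Delta_gt0.
rewrite !(@powR_sqr _ (dyadic_Delta _ _)) //.
rewrite -powRM ?invr_ge0 ?sqr_ge0 //.
apply: ge0_ler_powR; rewrite ?nnegrE ?sqr_ge0 ?mulr_ge0 ?invr_ge0 ?divr_ge0 ?(ltW g0) //.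
have hn : (0 < 2 ^ J.+1 <= 2 ^ J.+2)%N by rewrite expn_gt0 leq_exp2l //= ltnS leqnSn.
have := @Delta_degree_anti R (2 ^ J.+1) (2 ^ J.+2) x hn x01.
have -> : (2 ^ J.+1)%:R / (2 ^ J.+2)%:R = 2^-1 :> R.
  have h : (2 ^ J.+1)%:R != 0 :> R by rewrite pnatr_eq0 -lt0n expn_gt0.
  by rewrite (expnS 2 J.+1) natrM invfM mulrCA mulfV ?mulr1.
by [].
Qed.

Lemma dyadic_Delta_powR_le {R : realType} J (x g : R) : 0 <= x <= 1 -> 0 < g ->
  dyadic_Delta J x `^ g <= ((2^-1) `^ (g / 2)) ^+ J.
Proof.
move=> x01 g0; have r0 : 0 <= (2^-1 : R) `^ (g / 2) by exact: powR_ge0.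
elim: J => [|J IHJ].
  rewrite expr0 -[leRHS](_ : 1 `^ g = 1); last by rewrite powR1.
  apply: ge0_ler_powR; rewrite ?nnegrE ?(ltW g0) ?(ltW (dyadic_Delta_gt0 _ _)) //.
  exact: Delta_le1.
by apply: (le_trans (dyadic_Delta_step J x01 g0)); rewrite exprS ler_wpM2l.
Qed.

Lemma Delta_var_mono {R : realType} n (x z : R) : x * (1 - x) <= z * (1 - z) ->
  Delta n x <= Delta n z.
Proof.
move=> w; rewrite /Delta ge_max !le_max lexx orbT andbT.
by rewrite ler_wsqrtr // ler_wpM2r // invr_ge0.
Qed.

(** x (1 - x) is concave, so on a segment it is smallest at an end point. *)
Lemma var_segment_ge {R : realFieldType} (x y z : R) :
  x * (1 - x) <= y * (1 - y) -> `|z - x| <= `|y - x| -> `|z - y| <= `|y - x| ->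
  x * (1 - x) <= z * (1 - z).
Proof.
move=> w.
have wy : 0 <= (y - x) * (1 - x - y) by move: w; rewrite -subr_ge0 => w; nra.
suff : x <= z <= y \/ y <= z <= x -> x * (1 - x) <= z * (1 - z).
  move=> H h1 h2; apply: H.
  have [xy|yx] := leP x y; [left|right]; apply/andP.
    rewrite (ger0_norm (_ : 0 <= y - x)) ?subr_ge0 // in h1 h2.
    by move: h1 h2; rewrite !ler_norml => /andP[? ?] /andP[? ?]; split; lra.
  rewrite (ltr0_norm (_ : y - x < 0)) ?subr_lt0 // in h1 h2.
  by move: h1 h2; rewrite !ler_norml => /andP[? ?] /andP[? ?]; split; lra.
move=> zxy; rewrite -subr_ge0.
have -> : z * (1 - z) - x * (1 - x) = (z - x) * (1 - x - z) by ring.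
case: zxy => /andP[h1 h2].
  have [->|zx] := eqVneq z x; first by rewrite subrr mul0r.
  have zx' : x < z by rewrite lt_neqAle eq_sym zx.
  apply: mulr_ge0; first by rewrite subr_ge0.
  have yx : 0 < y - x by lra.
  by rewrite pmulr_rge0 // in wy; lra.
have [->|zx] := eqVneq z x; first by rewrite subrr mul0r.
have zx' : z < x by rewrite lt_neqAle zx.
rewrite -mulrNN; apply: mulr_ge0; first by lra.
have yx : y - x < 0 by lra.
by rewrite nmulr_rge0 // in wy; lra.
Qed.

(** With d the Delta of x and h = |y - x|: if d >= h, the mean value inequality
gives C d^(b - 1) h, since Delta is at least d between x and y.  If d < h, the
Delta of y is at most (2 d h)^(1/2), and the values at x and y themselves give
a bound of order (2 d h)^(b / 2).  Both are h^b times a positive power of d/h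
or of h/d. *)
Lemma increment_le {R : realType} n (u : {poly R}) (b C x y : R) : (0 < n)%N ->
  0 < b < 1 -> 0 <= C ->
  (forall z, 0 <= z <= 1 -> `|u.[z]| <= C * Delta n z `^ b) ->
  (forall z, 0 <= z <= 1 -> `|u^`().[z]| <= C * Delta n z `^ (b - 1)) ->
  0 <= x <= 1 -> 0 <= y <= 1 -> x * (1 - x) <= y * (1 - y) -> y != x ->
  let h := `|y - x| in
  let a := (Delta n x / h) `^ (Num.min (1 - b) (b / 2)) in
  is_true (`|u.[y] - u.[x]| <= 3 * C * h `^ b * Num.min a a^-1).
Proof.
move=> n0 /andP[b0 b1] C0 Hu Hu' x01 y01 w yx.
have d0 := Delta_gt0 x n0; have D0 := Delta_gt0 y n0.
set d := Delta n x in d0 *; set D := Delta n y in D0.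
set g := Num.min (1 - b) (b / 2); move=> h a.
have h0 : 0 < h by rewrite normr_gt0 subr_eq0.
have g1 : g <= 1 - b by rewrite ge_min lexx.
have g2 : g <= b / 2 by rewrite ge_min lexx orbT.
have g0 : 0 < g by rewrite lt_min subr_gt0 b1 divr_gt0.
pose t := d / h; have t0 : 0 < t by rewrite divr_gt0.
have dE : d = h * t by rewrite /t mulrCA mulfV ?mulr1 // gt_eqF.
have aE : a = t `^ g by [].
have a0 : 0 < a by rewrite powR_gt0.
have hb0 : 0 <= h `^ b by exact: powR_ge0.
have [t1|t1] := leP 1 t.
  have a1 : 1 <= a.
    rewrite aE -[leLHS](_ : 1 `^ g = 1); last by rewrite powR1.
    by apply: ge0_ler_powR; rewrite ?nnegrE ?(ltW g0) ?(ltW t0) ?ler01.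
  have -> : Num.min a a^-1 = a^-1 by rewrite min_r // (le_trans _ a1) // invf_le1.
  have hmvi : `|u.[y] - u.[x]| <= C * d `^ (b - 1) * h.
    apply: (deriv_on01_mvi (deriv_on01_poly u) x01 y01) => z z01 zx zy.
    apply: (le_trans (Hu' z z01)); rewrite ler_wpM2l //.
    have dz := Delta_var_mono n (var_segment_ge w zx zy).
    have dz0 := Delta_gt0 z n0.
    rewrite -[b - 1]opprB !powRN lef_pV2 ?posrE ?powR_gt0 //.
    by apply: ge0_ler_powR; rewrite ?nnegrE ?subr_ge0 ?(ltW b1) ?(ltW d0) ?(ltW dz0).
  apply: (le_trans hmvi).
  have -> : C * d `^ (b - 1) * h = C * h `^ b * t `^ (b - 1).
    rewrite dE powRM ?(ltW h0) ?(ltW t0) // -!mulrA; congr (_ * _).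
    rewrite mulrCA [RHS]mulrC; congr (_ * _).
    rewrite -{2}(powRr1 (ltW h0)) -powRD ?(gt_eqF h0) ?implybT // subrK //.
  rewrite -mulrA -[3 * C * _]mulrA -mulrA.
  have hX : C * (h `^ b * t `^ (b - 1)) <= C * (h `^ b * a^-1).
    rewrite ler_wpM2l // ler_wpM2l // aE -powRN; apply: ler_powR => //; lra.
  have hY : 0 <= C * (h `^ b * a^-1) by rewrite !mulr_ge0 // invr_ge0 ltW.
  by rewrite -!mulrA; lra.
have a1 : a <= 1.
  rewrite aE -[leRHS](_ : 1 `^ g = 1); last by rewrite powR1.
  by apply: ge0_ler_powR; rewrite ?nnegrE ?(ltW g0) ?(ltW t0) ?(ltW t1) ?ler01.
have -> : Num.min a a^-1 = a by rewrite min_l // (le_trans a1) // invf_ge1.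
have tle c : g <= c -> t `^ c <= a.
  move=> gc; rewrite aE; have -> : t `^ c = t `^ g * t `^ (c - g).
    by rewrite -powRD ?(gt_eqF t0) ?implybT // addrC subrK.
  rewrite ler_piMr ?powR_ge0 // -[leRHS](_ : 1 `^ (c - g) = 1); last by rewrite powR1.
  by apply: ge0_ler_powR; rewrite ?nnegrE ?subr_ge0 ?(ltW t0) ?(ltW t1) ?ler01.
have hd : d `^ b <= h `^ b * a.
  by rewrite dE powRM ?(ltW h0) ?(ltW t0) // ler_wpM2l // tle //; lra.
have hD : D `^ b <= 2 * (h `^ b * a).
  have hD2 : D ^+ 2 <= h ^+ 2 * (2 * t).
    have := Delta_sq_dist n0 x01 y01; rewrite -/d -/D distrC -/h.
    have hi : n%:R^-1 <= d := Delta_ge_inv n x.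
    have h1 : h * n%:R^-1 <= h * d by rewrite ler_wpM2l // ltW.
    have h2 : d ^+ 2 <= h * d.
      by rewrite expr2 ler_wpM2r ?(ltW d0) // dE ler_piMr // ltW.
    have -> : h ^+ 2 * (2 * t) = 2 * (h * d) by rewrite dE; ring.
    by lra.
  rewrite powR_sqr ?(ltW D0) //.
  apply: (@le_trans _ _ ((h ^+ 2 * (2 * t)) `^ (b / 2))).
    apply: ge0_ler_powR; rewrite ?nnegrE ?sqr_ge0 ?divr_ge0 ?(ltW b0) //.
    by rewrite mulr_ge0 ?sqr_ge0 // mulr_ge0 // ltW.
  have t20 : 0 <= 2 * t by rewrite mulr_ge0 // ltW.
  rewrite (powRM _ (sqr_ge0 h) t20) -[X in X * _](powR_sqr b (ltW h0)).
  rewrite [leRHS]mulrCA ler_wpM2l // powRM ?(ltW t0) // ler_pM ?powR_ge0 ?tle //.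
  by rewrite -[leRHS]powRr1 //; apply: ler_powR; lra.
have := Hu x x01; have := Hu y y01; rewrite -/d -/D => hy hx.
apply: (le_trans (ler_normB _ _)).
have := ler_wpM2l C0 hd; have := ler_wpM2l C0 hD.
by lra.
Qed.

(** * Smoothness of the sum of the series *)

Lemma horner_telescope {R : numFieldType} (p : nat -> {poly R}) J x :
  (p J).[x] = (p 0%N).[x] + \sum_(j < J) (p j.+1 - p j).[x].
Proof.
rewrite -horner_sum -(big_mkord xpredT (fun j => p j.+1 - p j)) telescope_sumr //.
by rewrite -hornerD addrC subrK.
Qed.

Lemma telescope_bounded {R : realType} (p : nat -> {poly R}) (b C : R) : 0 < b -> 0 <= C ->
  (forall J z, 0 <= z <= 1 -> `|(p J.+1 - p J).[z]| <= C * dyadic_Delta J z `^ b) ->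
  exists2 B, 0 <= B & forall J z, 0 <= z <= 1 -> `|(p J).[z]| <= B.
Proof.
move=> b0 C0 Hp; have [B0 B00 HB0] := poly_bound01 (p 0%N).
set rho := (2^-1 : R) `^ (b / 2).
have /andP[r0 r1] : 0 < rho < 1 by apply: half_powR_lt1; rewrite divr_gt0.
have r01 : 0 <= rho < 1 by rewrite ltW.
exists (B0 + C / (1 - rho)); first by rewrite addr_ge0 // divr_ge0 // subr_ge0 ltW.
move=> J z z01; rewrite horner_telescope (le_trans (ler_normD _ _)) // lerD ?HB0 //.
apply: (le_trans (ler_norm_sum _ _ _)).
apply: (@le_trans _ _ (\sum_(j < J) C * dyadic_Delta j z `^ b)).
  by apply: ler_sum => j _; exact: Hp.
rewrite -mulr_sumr ler_wpM2l //.
apply: (le_trans (geometric_sum_le J r01 (fun j => powR_ge0 _ _)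
  (fun j => dyadic_Delta_step j z01 b0))).
rewrite -[leRHS]mul1r ler_wpM2r ?invr_ge0 ?subr_ge0 ?(ltW r1) //.
exact: (dyadic_Delta_powR_le 0 z01 b0).
Qed.

Lemma telescope_cvg {R : realType} (p : nat -> {poly R}) (b C z : R) : 0 < b -> 0 <= C ->
  0 <= z <= 1 ->
  (forall J, `|(p J.+1 - p J).[z]| <= C * dyadic_Delta J z `^ b) ->
  cvgn (fun J => (p J).[z]).
Proof.
move=> b0 C0 z01 Hp; set rho := (2^-1 : R) `^ (b / 2).
have /andP[r0 r1] : 0 < rho < 1 by apply: half_powR_lt1; rewrite divr_gt0.
have cs : cvgn (series (fun J => (p J.+1 - p J).[z])).
  apply: normed_cvg; apply: (@series_le_cvg _ _ (geometric C rho)) => //=.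
  - by move=> n; rewrite mulr_ge0 // exprn_ge0 // ltW.
  - move=> n; apply: (le_trans (Hp n)); rewrite ler_wpM2l //.
    exact: dyadic_Delta_powR_le.
  by apply: is_cvg_geometric_series; rewrite gtr0_norm.
have -> : (fun J => (p J).[z]) =
    (fun J => (p 0%N).[z] + series (fun J => (p J.+1 - p J).[z]) J).
  by apply/funext => J; rewrite {1}horner_telescope /series /= big_mkord.
by apply: is_cvgD => //; exact: is_cvg_cst.
Qed.

(** Increments of the blocks decay geometrically on both sides of the block for
which Delta is close to |y - x|. *)
Lemma telescope_holder {R : realType} (p : nat -> {poly R}) (b C : R) : 0 < b < 1 ->
  0 <= C ->
  (forall J z, 0 <= z <= 1 -> `|(p J.+1 - p J).[z]| <= C * dyadic_Delta J z `^ b) ->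
  (forall J z, 0 <= z <= 1 ->
     `|(p J.+1 - p J)^`().[z]| <= C * dyadic_Delta J z `^ (b - 1)) ->
  exists2 K, 0 <= K & forall J x y, 0 <= x <= 1 -> 0 <= y <= 1 ->
     `|(p J).[y] - (p J).[x]| <= K * `|y - x| `^ b.
Proof.
move=> b01 C0 Hp Hp'; have /andP[b0 b1] := b01.
have [B0 B00 HB0] := poly_bound01 (p 0%N)^`().
set g := Num.min (1 - b) (b / 2).
have g0 : 0 < g by rewrite lt_min subr_gt0 b1 divr_gt0.
set rho := (2^-1 : R) `^ (g / 2).
have r01 : 0 < rho < 1 by apply: half_powR_lt1; rewrite divr_gt0.
have /andP[r0 r1] := r01.
have Q0 : 0 <= 2 / (1 - rho) by rewrite divr_ge0 // subr_ge0 ltW.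
have C30 : 0 <= 3 * C by rewrite mulr_ge0.
have K0 : 0 <= B0 + 3 * C * (2 / (1 - rho)) by rewrite addr_ge0 // mulr_ge0.
exists (B0 + 3 * C * (2 / (1 - rho))) => // J x y.
wlog w : x y / x * (1 - x) <= y * (1 - y) => [H x01 y01|x01 y01].
  have [w|w] := leP (x * (1 - x)) (y * (1 - y)); first exact: H.
  by rewrite distrC [in leRHS]distrC; apply: H => //; exact: ltW.
have [->|yx] := eqVneq y x.
  by rewrite !subrr normr0 mulr_ge0 ?powR_ge0.
set h := `|y - x|; have h0 : 0 < h by rewrite normr_gt0 subr_eq0.
have h1 : h <= 1.
  move: x01 y01 => /andP[x0 x1] /andP[y0 y1].
  by rewrite ler_norml; apply/andP; split; lra.
pose a j := (dyadic_Delta j x / h) `^ g.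
have -> : (p J).[y] - (p J).[x] = ((p 0%N).[y] - (p 0%N).[x]) +
    \sum_(j < J) ((p j.+1 - p j).[y] - (p j.+1 - p j).[x]).
  by rewrite (horner_telescope p J y) (horner_telescope p J x) sumrB; ring.
rewrite (le_trans (ler_normD _ _)) // mulrDl lerD //.
  have hb : h <= h `^ b by apply: ger1_powR; rewrite ?h0 ?(ltW b1).
  apply: (le_trans _ (ler_wpM2l B00 hb)).
  by apply: (deriv_on01_mvi (deriv_on01_poly (p 0%N)) x01 y01) => z z01 _ _; exact: HB0.
apply: (le_trans (ler_norm_sum _ _ _)).
apply: (@le_trans _ _ (\sum_(j < J) 3 * C * h `^ b * Num.min (a j) (a j)^-1)).
  apply: ler_sum => j _.
  have n0 : (0 < 2 ^ j.+1)%N by rewrite expn_gt0.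
  exact: (increment_le n0 b01 C0 (Hp j) (Hp' j)).
rewrite -mulr_sumr -[3 * C * (2 / _) * _]mulrA [2 / _ * _]mulrC mulrA.
rewrite ler_wpM2l //; first by rewrite mulr_ge0 ?powR_ge0.
apply: two_sided_geometric_sum_le => // j.
  by rewrite /a powR_gt0 // divr_gt0 // dyadic_Delta_gt0.
have d0 k : 0 <= dyadic_Delta k x by exact/ltW/dyadic_Delta_gt0.
rewrite /a !powRM ?invr_ge0 ?(ltW h0) // mulrA ler_wpM2r ?powR_ge0 //.
exact: dyadic_Delta_step.
Qed.

Lemma first_order_le {R : realType} (p : {poly R}) (K b x y : R) : 0 <= K -> 0 < b ->
  0 <= x <= 1 -> 0 <= y <= 1 ->
  (forall z, 0 <= z <= 1 -> `|p^`().[z] - p^`().[x]| <= K * `|z - x| `^ b) ->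
  `|p.[y] - p.[x] - (y - x) * p^`().[x]| <= K * `|y - x| `^ b * `|y - x|.
Proof.
move=> K0 b0 x01 y01 H.
(* p minus the linear part of its Taylor polynomial at x, up to a constant *)
pose q := p - p^`().[x] *: 'X.
have -> : p.[y] - p.[x] - (y - x) * p^`().[x] = q.[y] - q.[x].
  by rewrite /q !hornerD !hornerN !hornerZ !hornerX; ring.
apply: (deriv_on01_mvi (deriv_on01_poly q) x01 y01) => z z01 zx _.
rewrite /q derivB derivZ derivX hornerD hornerN hornerZ hornerC mulr1.
apply: (le_trans (H z z01)); rewrite ler_wpM2l //.
by apply: ge0_ler_powR; rewrite ?nnegrE ?(ltW b0).
Qed.

(** The r-th derivatives of the partial sums are uniformly Hoelder continuous,
and the lower ones uniformly Lipschitz.  So the first-order remainders of the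
partial sums have a uniform bound K h^(1 + b), which passes to the limit and
identifies the derivatives of f as the limits of those of the partial sums. *)
Lemma holder01_of_telescope {R : realType} (alpha : R) (f : R -> R) (P : nat -> {poly R}) :
  0 < alpha -> alpha \isn't a Num.int ->
  (forall x, 0 <= x <= 1 -> (P J).[x] @[J --> \oo] --> f x) ->
  (forall i, exists2 C, 0 <= C & forall J z, 0 <= z <= 1 ->
     `|(P J.+1 - P J)^`(i).[z]| <= C * dyadic_Delta J z `^ (alpha - i%:R)) ->
  holder01 alpha f.
Proof.
move=> a0 aint Pf HP; have /andP[ra ar] := truncn_nonint a0 aint.
set r := Num.truncn alpha in ra ar; pose b := alpha - r%:R.
have b0 : 0 < b by rewrite subr_gt0.
have b1 : b < 1 by rewrite ltrBlDr addrC.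
pose p i J := (P J)^`(i).
have pB i J : p i J.+1 - p i J = (P J.+1 - P J)^`(i) by rewrite derivnB.
have expo i : (i <= r)%N -> 0 < alpha - i%:R.
  by move=> leir; rewrite subr_gt0 (le_lt_trans _ ra) // ler_nat.
pose S i x := limn (fun J => (p i J).[x]).
have Scvg i x : (i <= r)%N -> 0 <= x <= 1 -> (p i J).[x] @[J --> \oo] --> S i x.
  move=> leir x01; have [C C0 HC] := HP i.
  by apply: (telescope_cvg (expo i leir) C0 x01) => J; rewrite pB; exact: HC.
have bounded i : (i <= r)%N -> exists2 B, 0 <= B &
    forall J z, 0 <= z <= 1 -> `|(p i J).[z]| <= B.
  move=> leir; have [C C0 HC] := HP i.
  by apply: (telescope_bounded (expo i leir) C0) => J z z01; rewrite pB; exact: HC.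
have holderP i : (i <= r)%N -> exists2 K, 0 <= K & forall J x y, 0 <= x <= 1 ->
    0 <= y <= 1 -> `|(p i J).[y] - (p i J).[x]| <= K * `|y - x| `^ b.
  rewrite leq_eqVlt => /orP[/eqP->|ltir].
    have [C C0 HC] := HP r; have [C' C'0 HC'] := HP r.+1.
    apply: (@telescope_holder _ _ _ (C + C')); rewrite ?b0 ?addr_ge0 //.
      move=> J z z01; rewrite pB (le_trans (HC J z z01)) // ler_wpM2r ?powR_ge0 //.
      by rewrite lerDl.
    move=> J z z01; rewrite pB -derivnS (le_trans (HC' J z z01)) //.
    rewrite -natr1 opprD addrA ler_wpM2r ?powR_ge0 // lerDr //.
  have [B B0 HB] := bounded i.+1 ltir; exists B => // J x y x01 y01.
  apply: (@le_trans _ _ (B * `|y - x|)).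
    apply: (deriv_on01_mvi (deriv_on01_poly (p i J)) x01 y01) => z z01 _ _.
    by rewrite /p -derivnS; exact: HB.
  rewrite ler_wpM2l //; have [->|yx] := eqVneq y x; first by rewrite subrr normr0 powR_ge0.
  apply: ger1_powR; last exact: ltW.
  rewrite normr_gt0 subr_eq0 yx /=.
  move: x01 y01 => /andP[? ?] /andP[? ?].
  by rewrite ler_norml; apply/andP; split; lra.
have Sderiv i : (i < r)%N -> deriv_on01 (S i) (S i.+1).
  move=> ltir x x01 e e0; have [K K0 HK] := holderP i.+1 ltir.
  have [d d0 Hd] := powR_small b0 K0 e0; exists d => // y y01 yxd.
  apply: (@le_trans _ _ (K * `|y - x| `^ b * `|y - x|)); last by rewrite ler_wpM2r // Hd.
  have H : `|(p i J).[y] - (p i J).[x] - (y - x) * (p i.+1 J).[x]| @[J --> \oo] -->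
      `|S i y - S i x - (y - x) * S i.+1 x|.
    apply: cvg_norm; apply: cvgB.
      by apply: cvgB; apply: Scvg => //; exact: ltnW.
    by apply: cvgMl_tmp; exact: Scvg.
  apply: (cvgr_to_le H); near=> J; rewrite /p derivnS.
  apply: first_order_le => // z z01; rewrite -derivnS; exact: HK.
have Sf x : 0 <= x <= 1 -> S 0%N x = f x by move=> x01; exact/cvg_lim/Pf.
have SE i : (i <= r)%N -> forall x, 0 <= x <= 1 -> derive01n i f x = S i x.
  elim: i => [_ x x01|i IHi ltir x x01]; first by rewrite Sf.
  have Hi : deriv_on01 (derive01n i f) (S i.+1).
    move=> z z01 e e0; have [d d0 Hd] := Sderiv i ltir z z01 e e0.
    by exists d => // y y01 yz; rewrite !IHi ?(ltnW ltir) //; exact: Hd.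
  by have [_] := derive01P Hi x01.
split=> [k ltkr x|].
  rewrite in_itv /= => x01.
  have Hk : deriv_on01 (derive01n k f) (S k.+1).
    move=> z z01 e e0; have [d d0 Hd] := Sderiv k ltkr z z01 e e0.
    by exists d => // y y01 yz; rewrite !SE ?(ltnW ltkr) //; exact: Hd.
  by have [] := derive01P Hk x01.
have [K K0 HK] := holderP r (leqnn r); exists K.
exists 1 => //= h _ h0; apply: ge_ereal_sup => _ /= [x [y [+ + xyh ->]]].
rewrite !in_itv /= => x01 y01; rewrite lee_fin !SE //.
apply: (@le_trans _ _ (K * `|x - y| `^ b)); last first.
  by rewrite ler_wpM2l //; apply: ge0_ler_powR; rewrite ?nnegrE ?(ltW b0) ?(ltW h0) ?(ltW xyh).
have H : `|(p r J).[x] - (p r J).[y]| @[J --> \oo] --> `|S r x - S r y|.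
  by apply: cvg_norm; apply: cvgB; apply: Scvg.
by apply: (cvgr_to_le H); near=> J; exact: HK.
Unshelve. all: by end_near.
Qed.

(** The block of terms of degrees in (2^J, 2^(J+1)] lies in the cone of degree
2^(J+1) and is at most the tail at 2^J, so cone_deriv_le applies to it. *)
Lemma holder01_of_Bernstein_series {R : realType} (alpha : R) (f : R -> R) F : 0 < alpha ->
  alpha \isn't a Num.int -> Bernstein_series alpha f F -> holder01 alpha f.
Proof.
move=> a0 aint [Fcone Fcvg [C HC]].
pose P J := \sum_(1 <= n < (2 ^ J).+1) F n.
have Pdiff J : P J.+1 - P J = \sum_((2 ^ J).+1 <= n < (2 ^ J.+1).+1) F n.
  have le2 : ((2 ^ J).+1 <= (2 ^ J.+1).+1)%N by rewrite ltnS leq_exp2l.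
  have le1 : (1 <= (2 ^ J).+1)%N by [].
  by rewrite /P (big_cat_nat le1 le2) /= addrAC subrr add0r.
have Pcone J : bernstein_cone (2 ^ J.+1) (P J.+1 - P J).
  rewrite Pdiff big_nat_cond; apply: (big_ind (bernstein_cone (2 ^ J.+1))).
  - exact: cone0.
  - by move=> *; exact: coneD.
  move=> n /andP[/andP[n1 n2] _]; apply: (@cone_elevation _ n) => //.
  by apply: Fcone; exact: leq_trans n1.
pose K := `|C| * 2 `^ alpha.
have K0 : 0 <= K by rewrite mulr_ge0 ?powR_ge0.
have Pbound J z : 0 <= z <= 1 -> (P J.+1 - P J).[z] <= K * Delta (2 ^ J.+1) z `^ alpha.
  move=> z01; have J0 : (0 < 2 ^ J)%N by rewrite expn_gt0.
  have hz : z \in `[0, 1] by rewrite in_itv.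
  have := HC z hz _ J0.
  have := @nneseries_lim_ge R (fun k => ((F k).[z])%:E) xpredT (2 ^ J).+1 (2 ^ J.+1).+1.
  move=> /(_ _)/le_trans H /H; rewrite sumEFin lee_fin => {}H.
  rewrite Pdiff horner_sum; apply: le_trans (H _) _.
    by move=> n n1 _; rewrite lee_fin (cone_horner_ge0 (Fcone n _)) // (leq_trans _ n1).
  apply: (@le_trans _ _ (`|C| * Delta (2 ^ J) z `^ alpha)).
    by rewrite ler_wpM2r ?powR_ge0 // ler_norm.
  have D1 := Delta_gt0 z J0.
  have J1 : (0 < 2 ^ J.+1)%N by rewrite expn_gt0.
  have D2 := Delta_gt0 z J1.
  rewrite /K -mulrA ler_wpM2l // -powRM ?(ltW D2) //.
  apply: ge0_ler_powR; rewrite ?nnegrE ?mulr_ge0 ?(ltW a0) ?(ltW D1) ?(ltW D2) //.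
  have hn : (0 < 2 ^ J <= 2 ^ J.+1)%N by rewrite expn_gt0 leq_exp2l //= leqnSn.
  have := @Delta_degree_mono R (2 ^ J) (2 ^ J.+1) z hn z01.
  suff -> : (2 ^ J.+1)%:R / (2 ^ J)%:R = 2 :> R by [].
  by rewrite expnS natrM mulfK // pnatr_eq0 -lt0n.
apply: (@holder01_of_telescope _ _ _ P) => // [x x01|i].
  have hx : x \in `[0, 1] by rewrite in_itv.
  have -> : (fun J => (P J).[x]) =
      (fun N => \sum_(1 <= n < N) (F n).[x]) \o (fun J => (2 ^ J).+1).
    by apply/funext => J /=; rewrite /P horner_sum.
  apply: (cvg_comp _ _ _ (Fcvg x hx)).
  apply/cvgnyPge => m; exists m => // J /= mJ.
  by rewrite (leq_trans mJ) // ltnW // ltnS ltnW // ltn_expl.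
have [Ci Ci0 HCi] := @cone_deriv_le R i alpha (ltW a0).
exists (Ci * K); first by rewrite mulr_ge0.
move=> J z z01; have J1 : (0 < 2 ^ J.+1)%N by rewrite expn_gt0.
have D0 := dyadic_Delta_gt0 J z.
have := HCi _ _ _ _ J1 (Pcone J) K0 (Pbound J) z01; rewrite -/(dyadic_Delta J z).
rewrite -ler_pdivlMr ?exprn_gt0 // => /le_trans; apply.
rewrite powRB; last by rewrite (gt_eqF D0) implybT.
by rewrite (powR_mulrn _ (ltW D0)) [leRHS]mulrA.
Qed.

Theorem mainTheorem2 (R : realType) (alpha : R) (f : R -> R)
    (alpha_gt0 : 0 < alpha) (alpha_nint : alpha \isn't a Num.int)
    (f01 : forall x, x \in `[0, 1] -> 0 < f x < 1) :
  holder01 alpha f <->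
  exists F : nat -> {poly R},
    [/\ forall n, (1 <= n)%N -> bernstein_cone n (F n),
        forall x, x \in `[0, 1] ->
          \sum_(1 <= n < N) (F n).[x] @[N --> \oo] --> f x
      & exists C : R, forall x, x \in `[0, 1] -> forall n, (1 <= n)%N ->
          (\sum_(n.+1 <= k <oo) ((F k).[x])%:E
             <= (C * (Delta n x) `^ alpha)%:E)%E].
Proof.
split=> [Hf|[F HF]].
  by apply: Bernstein_series_of_holder01 => // x /f01/andP[].
exact: (@holder01_of_Bernstein_series _ _ _ F).
Qed.
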